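(* Let $\phi,\psi,\sigma\in L^\infty$, and let $\alpha,\beta,\theta$ be three non-constant inner functions. Then $D^{\alpha,\beta}_\psi D^{\theta,\alpha}_\phi=D^{\theta,\beta}_\sigma$ if and only if $\sigma=\phi\psi$ and one of the following statements holds. (1) $\psi,\ \bar\alpha\beta\bar\psi\in H^\infty$; (2) $\bar\phi,\ \theta\bar\alpha\phi\in H^\infty$; (3) there is a constant $\lambda$ with $|\lambda|<1$ such that $\bar\phi,\ (1-\lambda\bar\alpha)\theta\phi,\ (\bar\alpha-\bar\lambda)\beta\bar\psi,\ (\alpha-\lambda)\psi,\ (1-\lambda\bar\alpha)\theta\phi\psi\in H^\infty$; (4) there is a constant $\lambda$ with $|\lambda|<1$ such that $\psi,\ (1-\lambda\bar\alpha)\beta\bar\psi,\ (\bar\alpha-\bar\lambda)\theta\phi,\ (\alpha-\lambda)\bar\phi,\ (1-\lambda\bar\alpha)\beta\bar\phi\bar\psi\in H^\infty$.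
   Context: $L^2$ and $L^\infty$ are the Lebesgue spaces of the unit circle $\mathbb T$ with normalized Lebesgue measure. $H^2\subset L^2$ is the Hardy space, $P_+$ is the orthogonal projection of $L^2$ onto $H^2$, $P_-=I-P_+$, and $H^\infty=L^\infty\cap H^2$. A bar denotes complex conjugation. For a non-constant inner function $\theta$, $K_\theta=H^2\ominus\theta H^2$ is the model space and $K_\theta^\perp=L^2\ominus K_\theta=\theta H^2\oplus\bar z\overline{H^2}$. For $\phi\in L^\infty$ and non-constant inner functions $\theta,\alpha$, the asymmetric dual truncated Toeplitz operator $D^{\theta,\alpha}_\phi:K_\theta^\perp\to K_\alpha^\perp$ is defined by $D^{\theta,\alpha}_\phi x=(P_-+\alpha P_+\bar\alpha)(\phi x)$, i.e. $D^{\theta,\alpha}_\phi x=P_-(\phi x)+\alpha P_+(\bar\alpha\phi x)$. *)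

(* Defs.v *)
From HB Require Import structures.
From mathcomp Require Import all_boot all_order all_algebra.
From mathcomp Require Import complex.
From mathcomp Require Import all_classical all_reals all_analysis.

Set Implicit Arguments.
Unset Strict Implicit.
Unset Printing Implicit Defensive.

Import Order.TTheory GRing.Theory Num.Theory.
Import numFieldNormedType.Exports.

Local Open Scope classical_set_scope.
Local Open Scope ring_scope.

(* [`|z|] on [R[i]] is complex-valued; this is the same modulus with values
   in R. *)
Definition cabs (R : realType) (z : R[i]) : R := complex.Re `|z|.

Record circle (R : realType) := Circle {
  circle_val :> R[i];
  circle_norm : `|circle_val| == 1 }.

Section circle.
Context {R : realType}.

Lemma norm_expi (t : R) : `|(cos t +i* sin t)%C| == 1 :> R[i].
Proof. by rewrite normc_def /= cos2Dsin2 sqrtr1. Qed.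

(* [measurableTypeR R] is R with the sigma-algebra carried by
   [lebesgue_measure]. *)
Definition expi (t : measurableTypeR R) : circle R := Circle (norm_expi t).

HB.instance Definition _ := [isSub for @circle_val R].
HB.instance Definition _ := [Choice of circle R by <:].
HB.instance Definition _ := isPointed.Build (circle R) (expi 0).

Definition circle_coord (z : circle R) : R * R :=
  (complex.Re z, complex.Im z).

(* The Borel sigma-algebra of the circle: the trace of that of C = R^2. *)
HB.instance Definition _ := Measurable.copy (circle R)
  (g_sigma_algebra_preimageType circle_coord).

Lemma measurable_expi : measurable_fun [set: measurableTypeR R] expi.
Proof.
move=> _ _ [B mB <-]; rewrite !setTI -comp_preimage -[X in measurable X]setTI.
have mc : measurable_fun [set: measurableTypeR R] (circle_coord \o expi).
  apply/measurable_fun_pairP; split.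
  - apply: measurable_realfun.continuous_measurable_fun => x.
    exact: continuous_cos.
  - apply: measurable_realfun.continuous_measurable_fun => x.
    exact: continuous_sin.
by apply: mc.
Qed.

HB.instance Definition _ := isMeasurableFun.Build _ _ _ _ expi measurable_expi.

Lemma ltr0_2pi : 0 < 2 * pi :> R.
Proof. by rewrite mulr_gt0// pi_gt0. Qed.

End circle.

(* Normalized Lebesgue measure on the circle: the image under
   t |-> exp(i t) of the uniform probability on [0, 2 pi]. *)
Definition circle_measure (R : realType) : probability (circle R) R :=
  distribution (uniform_prob (@ltr0_2pi R))
    (expi : {mfun measurableTypeR R >-> circle R}).

Section function_spaces.
Context {R : realType}.
Local Notation C := R[i].
Local Notation T := (circle R).
Local Notation m := (circle_measure R).
Implicit Types f g h x : T -> C.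

Definition conjf f : T -> C := fun z => (f z)^*%C.

Definition cmeasurable f :=
  measurable_fun [set: T] (fun z => complex.Re (f z)) /\
  measurable_fun [set: T] (fun z => complex.Im (f z)).

Definition cintegral f : C :=
  (Rintegral m [set: T] (fun z => complex.Re (f z)) +i*
   Rintegral m [set: T] (fun z => complex.Im (f z)))%C.

(* Elements of the function spaces below are representatives; the elements of
   the actual spaces are their classes modulo equality m-almost everywhere. *)
Definition L (p : \bar R) : set (T -> C) :=
  [set f | cmeasurable f /\ finite_norm m p (@cabs R \o f)].

Definition inner_prod f g : C := cintegral (f * conjf g).

Definition fourier f (n : int) : C :=
  cintegral (fun z => f z * (z : C) ^ (- n)).

Definition H2 : set (T -> C) :=
  [set f | L 2%:E f /\ forall n : int, n < 0 -> fourier f n = 0].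

Definition Hinf : set (T -> C) := L +oo%E `&` H2.

(* [M^perp] relative to the subspace [E]. *)
Definition ominus (E M : set (T -> C)) : set (T -> C) :=
  [set f | E f /\ forall g, M g -> inner_prod f g = 0].

(* Orthogonal projection of [f] onto the closed subspace [M] of L^2: a choice
   of representative of the point [g] of [M] with [f - g] orthogonal to [M].
   It depends on [f] only through its class. *)
Definition oproj (M : set (T -> C)) f : T -> C :=
  xget 0 [set g | M g /\ forall h, M h -> inner_prod (f - g) h = 0].

Definition Pplus f : T -> C := oproj H2 f.
Definition Pminus f : T -> C := f - Pplus f.

Definition inner_fun (theta : T -> C) :=
  Hinf theta /\ {ae m, forall z, `|theta z| = 1}.

Definition nonconstant f := ~ exists c : C, f = cst c %[ae m].

Definition K (theta : T -> C) : set (T -> C) :=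
  ominus H2 [set theta * h | h in H2].

Definition Kperp (theta : T -> C) : set (T -> C) := ominus (L 2%:E) (K theta).

(* The operator [D^{theta,alpha}_phi]; it is extended by 0 outside its domain
   [Kperp theta], which it maps into [Kperp alpha]. *)
Definition adtt (theta alpha phi : T -> C) : (T -> C) -> (T -> C) :=
  patch (fun=> 0) (Kperp theta)
    (fun x => Pminus (phi * x) + alpha * Pplus (conjf alpha * phi * x)).

End function_spaces.

(* Main.v *)
Require Import Defs.
From HB Require Import structures.
From mathcomp Require Import all_boot all_order all_algebra.
From mathcomp Require Import complex.
From mathcomp Require Import all_classical all_reals all_analysis.
From mathcomp Require Import ring lra zify.

Import Order.TTheory GRing.Theory Num.Theory.
Import numFieldNormedType.Exports.

Import measurable_realfun.

(** Let P be the orthogonal projection of L^2 onto the model space of alpha. Since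
    D_phi x = phi x - P (phi x), and similarly for the other two operators, the
    operator identity says that, for all x in the complement of the model space of
    theta, the function (phi psi - sigma) x - psi P (phi x) lies in the model space
    of beta. That complement is the sum of theta H^2 and of the complement of H^2,
    and a function w lies in the model space of beta when w is in H^2 and
    conj beta w is orthogonal to H^2.

    Necessity rests on the commutator of P with multiplication by z: the function
    z P u - P (z u) is b alpha - a, with a and b the means of z u and of
    conj alpha z u (Pa_z). Comparing the condition at x and at z x thus removes the
    symbol phi psi - sigma and shows that psi (b alpha - a) is analytic for a linear
    family of pairs (a, b). Either psi is analytic, or the pairs all vanish, or they
    are proportional, a = lam b (pencil). In the last case |lam| < 1, because
    1 - mu alpha with |mu| <= 1 can be divided out of an analytic function
    (inner_div). For x orthogonal to H^2 this gives that psi or conj phi is analytic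
    (product_on_Hm_cases), and then that sigma = phi psi (product_symbol). For x in
    theta H^2 it gives that psi is analytic, or theta conj alpha phi is, or there is
    a lam as in the third alternative (condB_cases).

    The conjugations u |-> alpha conj (z u), and likewise for beta and theta, carry
    the problem for (phi, psi) to the same problem for
    (alpha conj theta conj phi, conj alpha beta conj psi), with the two summands of
    the complement exchanged. Hence also conj alpha beta conj psi or
    theta conj alpha phi is analytic. Of the four combinations two are the first
    two alternatives, and the other two lead to the third one and to its dual, the
    fourth one (cond_iff). For sufficiency the
    point is that, when (1 - lam conj alpha) u is analytic, P u differs from it by a
    multiple of alpha - lam (Pa_lam).

    Underneath lie two facts about L^2 of the circle: a function with vanishing
    Fourier coefficients is zero (fourier_inj), and orthogonal projections exist
    (orth_projection). Together they give that the complement of H^2 consists of the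
    functions whose coefficients of index >= 0 vanish, and that the product of a
    bounded analytic function with an H^2 function is in H^2. *)

Set Implicit Arguments.
Unset Strict Implicit.
Unset Printing Implicit Defensive.

Local Open Scope classical_set_scope.
Local Open Scope ring_scope.

(** * Complex numbers by real and imaginary parts *)

Section complex_algebra.
Context {R : realType}.
Implicit Types x y : R[i].

Lemma ReD x y : complex.Re (x + y) = complex.Re x + complex.Re y.
Proof. by case: x => a b; case: y. Qed.
Lemma ImD x y : complex.Im (x + y) = complex.Im x + complex.Im y.
Proof. by case: x => a b; case: y. Qed.
Lemma ReN x : complex.Re (- x) = - complex.Re x.
Proof. by case: x. Qed.
Lemma ImN x : complex.Im (- x) = - complex.Im x.
Proof. by case: x. Qed.
Lemma ReM x y : complex.Re (x * y) =
  complex.Re x * complex.Re y - complex.Im x * complex.Im y.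
Proof. by case: x => a b; case: y. Qed.
Lemma ImM x y : complex.Im (x * y) =
  complex.Re x * complex.Im y + complex.Im x * complex.Re y.
Proof. by case: x => a b; case: y. Qed.
Lemma ReJ x : complex.Re (x^*)%C = complex.Re x.
Proof. by case: x. Qed.
Lemma ImJ x : complex.Im (x^*)%C = - complex.Im x.
Proof. by case: x. Qed.
Lemma Re0 : complex.Re (0 : R[i]) = 0. Proof. by []. Qed.
Lemma Im0 : complex.Im (0 : R[i]) = 0. Proof. by []. Qed.
Lemma Re1 : complex.Re (1 : R[i]) = 1. Proof. by []. Qed.
Lemma Im1 : complex.Im (1 : R[i]) = 0. Proof. by []. Qed.

Lemma cJD x y : ((x + y)^*)%C = x^*%C + y^*%C.
Proof. exact: rmorphD. Qed.
Lemma cJM x y : ((x * y)^*)%C = x^*%C * y^*%C.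
Proof. exact: rmorphM. Qed.
Lemma cJN x : ((- x)^*)%C = - x^*%C.
Proof. exact: rmorphN. Qed.

Definition ReImE := (ReD, ImD, ReN, ImN, ReM, ImM, ReJ, ImJ, Re0, Im0, Re1, Im1).

Lemma eqC x y : complex.Re x = complex.Re y -> complex.Im x = complex.Im y ->
  x = y.
Proof. by case: x => a b; case: y => c d /= -> ->. Qed.

(** The squared modulus as a real number; unlike the modulus it is a polynomial
    in the two parts and makes measurability and integrability immediate. *)
Definition nsq x : R := complex.Re x ^+ 2 + complex.Im x ^+ 2.

Lemma nsq_ge0 x : 0 <= nsq x. Proof. by rewrite addr_ge0 ?sqr_ge0. Qed.

Lemma nsqM x y : nsq (x * y) = nsq x * nsq y.
Proof. by rewrite /nsq !ReImE; ring. Qed.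

Lemma nsqJ x : nsq (x^*)%C = nsq x.
Proof. by rewrite /nsq !ReImE; ring. Qed.

Lemma nsqN x : nsq (- x) = nsq x.
Proof. by rewrite /nsq !ReImE; ring. Qed.

Lemma nsq0 : nsq 0 = 0. Proof. by rewrite /nsq !ReImE; ring. Qed.
Lemma nsq1 : nsq 1 = 1. Proof. by rewrite /nsq !ReImE; ring. Qed.

Lemma nsqD_le x y : nsq (x + y) <= 2 * nsq x + 2 * nsq y.
Proof.
rewrite /nsq !ReImE -subr_ge0.
have -> : 2 * (complex.Re x ^+ 2 + complex.Im x ^+ 2) +
  2 * (complex.Re y ^+ 2 + complex.Im y ^+ 2) -
  ((complex.Re x + complex.Re y) ^+ 2 + (complex.Im x + complex.Im y) ^+ 2) =
  (complex.Re x - complex.Re y) ^+ 2 + (complex.Im x - complex.Im y) ^+ 2.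
  by ring.
by rewrite addr_ge0 ?sqr_ge0.
Qed.

Lemma nsq_eq0 x : nsq x = 0 -> x = 0.
Proof.
move=> /eqP; rewrite paddr_eq0 ?sqr_ge0// !sqrf_eq0 => /andP[/eqP a /eqP b].
exact: eqC.
Qed.

Lemma nsqE x : (nsq x)%:C%C = x * (x^*)%C.
Proof. by apply: eqC; rewrite /nsq /= !ReImE; ring. Qed.

Lemma normC_nsq x : `|x| = (Num.sqrt (nsq x))%:C%C.
Proof. by rewrite normc_def. Qed.

Lemma cabsE x : cabs x = Num.sqrt (nsq x).
Proof. by rewrite /cabs normC_nsq. Qed.

Lemma norm1_nsq x : `|x| = 1 -> nsq x = 1.
Proof.
rewrite normC_nsq => -[] h; rewrite -(sqr_sqrtr (nsq_ge0 x)) h.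
by rewrite expr1n.
Qed.

Lemma norm1_mulJ x : `|x| = 1 -> x * (x^*)%C = 1.
Proof. by move=> /norm1_nsq h; rewrite -nsqE h. Qed.

Lemma normC_lt1 x : (`|x| < 1) = (nsq x < 1).
Proof.
rewrite normC_nsq -[X in _ < X]/((1 : R)%:C%C) ltcR.
by rewrite -{1}(@sqrtr1 R) ltr_sqrt.
Qed.

End complex_algebra.

(** * Square integrable and essentially bounded functions on the circle *)

Section square_integrable.
Context {R : realType}.
Local Notation C := R[i].
Local Notation T := (circle R).
Local Notation m := (circle_measure R).
Implicit Types f g h : T -> C.

Definition aeq f g := \forall x \ae m, f x = g x.

Lemma aeqE f g : (f = g %[ae m]) <-> aeq f g.
Proof.
by split => h; apply: filterS h => x; [exact|move=> ? _].
Qed.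

Lemma aeq_refl f : aeq f f. Proof. exact: aeW. Qed.
Lemma aeq_sym f g : aeq f g -> aeq g f.
Proof. by apply: filterS => x ->. Qed.
Lemma aeq_trans f g h : aeq f g -> aeq g h -> aeq f h.
Proof. by apply: filterS2 => x -> ->. Qed.

Lemma cmeasD f g : cmeasurable f -> cmeasurable g -> cmeasurable (f + g).
Proof.
move=> [f1 f2] [g1 g2]; split.
- by under eq_fun do rewrite !ReImE; exact: measurable_funD.
- by under eq_fun do rewrite !ReImE; exact: measurable_funD.
Qed.

Lemma cmeasM f g : cmeasurable f -> cmeasurable g -> cmeasurable (f * g).
Proof.
move=> [f1 f2] [g1 g2]; split.
- under eq_fun do rewrite !ReImE; apply: measurable_funB => //; exact: measurable_funM.
- under eq_fun do rewrite !ReImE; apply: measurable_funD => //; exact: measurable_funM.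
Qed.

Lemma cmeasJ f : cmeasurable f -> cmeasurable (conjf f).
Proof.
move=> [f1 f2]; split.
- by rewrite /conjf; under eq_fun do rewrite !ReImE.
- by rewrite /conjf; under eq_fun do rewrite !ReImE; exact: measurableT_comp.
Qed.

Lemma cmeasN f : cmeasurable f -> cmeasurable (- f).
Proof.
move=> [f1 f2]; split.
- by under eq_fun do rewrite !ReImE; exact: measurableT_comp.
- by under eq_fun do rewrite !ReImE; exact: measurableT_comp.
Qed.

Lemma cmeas_cst (c : C) : cmeasurable (cst c : T -> C).
Proof. by split; exact: measurable_cst. Qed.

Lemma cmeas0 : cmeasurable (0 : T -> C). Proof. exact: cmeas_cst. Qed.

Lemma measurable_coord : measurable_fun [set: T] (@circle_coord R).
Proof. by move=> _ B mB; rewrite setTI; exists B => //; rewrite setTI. Qed.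

Definition zf : T -> C := fun z => z.

Lemma cmeas_z : cmeasurable zf.
Proof.
split; [exact: (measurableT_comp measurable_fst measurable_coord)
       |exact: (measurableT_comp measurable_snd measurable_coord)].
Qed.

Lemma cmeas_nsq f : cmeasurable f -> measurable_fun [set: T] (nsq \o f).
Proof.
move=> [f1 f2]; apply: measurable_funD; exact: measurable_funX.
Qed.

Definition intg (f : T -> R) := m.-integrable [set: T] (EFin \o f).
Local Notation Rint f := (Rintegral m [set: T] f).

Lemma intgD (f g : T -> R) : intg f -> intg g -> intg (f \+ g).
Proof. by move=> f1 g1; exact: (integrableD measurableT f1 g1). Qed.

Lemma intgZ (f : T -> R) (r : R) : intg f -> intg (fun x => r * f x).
Proof. by move=> f1; exact: (integrableZl measurableT r f1). Qed.

Lemma intg_le (f g : T -> R) : measurable_fun [set: T] f ->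
  (forall x, `|f x| <= g x) -> intg g -> intg f.
Proof.
move=> mf fg ig; apply: (le_integrable measurableT _ _ ig).
  exact/measurable_EFinP.
move=> x _ /=; rewrite lee_fin (le_trans (fg x))// ler_norm//.
Qed.

Lemma intg_meas (f : T -> R) : intg f -> measurable_fun [set: T] f.
Proof. by move=> /measurable_int/measurable_EFinP. Qed.

Lemma intg_cst (r : R) : intg (fun=> r).
Proof. exact: finite_measure_integrable_cst. Qed.

Lemma intg_aele (f g : T -> R) : measurable_fun [set: T] f ->
  (\forall x \ae m, `|f x| <= g x) -> intg g -> intg f.
Proof.
move=> mf fg ig; apply/integrableP; split; first exact/measurable_EFinP.
have /integrableP[_] := ig; apply: le_lt_trans.
apply: ae_ge0_le_integral => //.
- by apply: measurableT_comp => //; exact/measurable_EFinP.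
- by apply: measurableT_comp => //; exact: measurable_int ig.
- by apply: filterS fg => x h _ /=; rewrite lee_fin (le_trans h)// ler_norm.
Qed.

Lemma Rint_aeq (f g : T -> R) : measurable_fun [set: T] f ->
  measurable_fun [set: T] g -> (\forall x \ae m, f x = g x) -> Rint f = Rint g.
Proof.
move=> mf mg fg; congr fine; apply: ae_eq_integral => //.
- exact/measurable_EFinP.
- exact/measurable_EFinP.
- by apply: filterS fg => x h _ /=; rewrite h.
Qed.

Lemma Rint_eq0 (f : T -> R) : intg f -> (forall x, 0 <= f x) -> Rint f = 0 ->
  \forall x \ae m, f x = 0.
Proof.
move=> fi f0 h.
have : (\int[m]_x `|(EFin \o f) x|%E = 0)%E.
  rewrite -[RHS]/(0%:E) -h /Rintegral fineK; last exact: integrable_fin_num.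
  by apply: eq_integral => x _ /=; rewrite ger0_norm.
move/(ae_eq_integral_abs _ measurableT (measurable_int _ fi)).
by apply: filterS => x /(_ I) /= [].
Qed.

Lemma L2E f : L 2%:E f <-> cmeasurable f /\ intg (nsq \o f).
Proof.
have key : cmeasurable f ->
    finite_norm m 2%:E (@cabs R \o f) <-> intg (nsq \o f).
  move=> mf; rewrite /finite_norm unlock /Lnorm.
  have -> : (\int[m]_x `|(EFin \o (@cabs R \o f)) x| `^ 2 =
             \int[m]_x `|(EFin \o (nsq \o f)) x|)%E.
    apply: eq_integral => x _ /=.
    rewrite cabsE ger0_norm ?sqrtr_ge0// ger0_norm ?nsq_ge0//.
    by rewrite powR_mulrn ?sqrtr_ge0// sqr_sqrtr ?nsq_ge0.
  split => [h|/integrableP[_ h]].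
    apply/integrableP; split; first exact/measurable_EFinP/cmeas_nsq.
    move: h; rewrite lt_neqAle => /andP[h _]; rewrite ltey; apply: contra h.
    by move=> /eqP ->; rewrite poweRyr ?invr_eq0.
  have : (\int[m]_x `|(EFin \o (nsq \o f)) x|)%E \is a fin_num.
    by rewrite ge0_fin_numE// integral_ge0.
  by move=> /fineK <-; rewrite poweR_EFin ltry.
by split => [[mf /(key mf)]|[mf /(key mf)]].
Qed.

Lemma LooE f : L +oo%E f <-> cmeasurable f /\
  exists M : R, \forall x \ae m, nsq (f x) <= M.
Proof.
have m1 : (0 < m [set: T])%E by rewrite probability_setT.
split => [[mf]|[mf [M fM]]].
  rewrite /finite_norm unlock /Lnorm m1 => h; split => //.
  have [r hr] : exists r : R,
      (ess_sup_inf.ess_sup m (abse \o (EFin \o (@cabs R \o f))) <= r%:E)%E.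
    move: h; case: (ess_sup_inf.ess_sup _ _) => [r|//|] _; first by exists r.
    by exists 0; rewrite leNye.
  exists (r ^+ 2); move/ess_sup_inf.ess_supP : hr; apply: filterS => x /=.
  rewrite lee_fin cabsE ger0_norm ?sqrtr_ge0// => h1.
  by rewrite -(sqr_sqrtr (nsq_ge0 (f x))) lerXn2r// ?nnegrE ?sqrtr_ge0// (le_trans _ h1)// sqrtr_ge0.
split => //; rewrite /finite_norm unlock /Lnorm m1.
apply: (@le_lt_trans _ _ (Num.sqrt M)%:E); last by rewrite ltry.
apply/ess_sup_inf.ess_supP; apply: filterS fM => x h /=.
by rewrite lee_fin cabsE ger0_norm ?sqrtr_ge0// ler_wsqrtr.
Qed.

Lemma L2_cmeas f : L 2%:E f -> cmeasurable f. Proof. by case. Qed.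
Lemma Loo_cmeas f : L +oo%E f -> cmeasurable f. Proof. by case. Qed.

Lemma L2D f g : L 2%:E f -> L 2%:E g -> L 2%:E (f + g).
Proof.
move=> /L2E[mf fi] /L2E[mg gi]; have mfg := cmeasD mf mg; apply/L2E; split => //.
apply: (intg_le (cmeas_nsq mfg) _ (intgD (intgZ 2 fi) (intgZ 2 gi))) => x.
by rewrite /= ger0_norm ?nsq_ge0// nsqD_le.
Qed.

Lemma L2N f : L 2%:E f -> L 2%:E (- f).
Proof.
move=> /L2E[mf fi]; apply/L2E; split; first exact: cmeasN.
by rewrite (_ : nsq \o _ = nsq \o f)//; apply: funext => x /=; rewrite nsqN.
Qed.

Lemma L2B f g : L 2%:E f -> L 2%:E g -> L 2%:E (f - g).
Proof. by move=> f2 g2; apply: L2D => //; exact: L2N. Qed.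

Lemma L2J f : L 2%:E f -> L 2%:E (conjf f).
Proof.
move=> /L2E[mf fi]; apply/L2E; split; first exact: cmeasJ.
by rewrite (_ : nsq \o _ = nsq \o f)//; apply: funext => x /=; rewrite nsqJ.
Qed.

Lemma L2M f g : L +oo%E f -> L 2%:E g -> L 2%:E (f * g).
Proof.
move=> /LooE[mf [M fM]] /L2E[mg gi]; have mfg := cmeasM mf mg.
apply/L2E; split => //; apply: (intg_aele (cmeas_nsq mfg) _ (intgZ M gi)).
apply: filterS fM => x h; rewrite ger0_norm ?nsq_ge0//= nsqM.
by rewrite ler_wpM2r ?nsq_ge0.
Qed.

Lemma Loo_bnd f (M : R) : cmeasurable f -> (forall x, nsq (f x) <= M) ->
  L +oo%E f.
Proof. by move=> mf h; apply/LooE; split => //; exists M; exact: aeW. Qed.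

Lemma LooM f g : L +oo%E f -> L +oo%E g -> L +oo%E (f * g).
Proof.
move=> /LooE[mf [M fM]] /LooE[mg [N gN]]; apply/LooE; split; first exact: cmeasM.
exists (M * N); apply: filterS2 fM gN => x h1 h2; rewrite nsqM.
by apply: ler_pM => //; exact: nsq_ge0.
Qed.

Lemma LooD f g : L +oo%E f -> L +oo%E g -> L +oo%E (f + g).
Proof.
move=> /LooE[mf [M fM]] /LooE[mg [N gN]]; apply/LooE; split; first exact: cmeasD.
exists (2 * M + 2 * N); apply: filterS2 fM gN => x h1 h2.
by apply: (le_trans (nsqD_le _ _)); lra.
Qed.

Lemma LooN f : L +oo%E f -> L +oo%E (- f).
Proof.
move=> /LooE[mf [M fM]]; apply/LooE; split; first exact: cmeasN.
by exists M; apply: filterS fM => x; rewrite nsqN.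
Qed.

Lemma LooB f g : L +oo%E f -> L +oo%E g -> L +oo%E (f - g).
Proof. by move=> f2 g2; apply: LooD => //; exact: LooN. Qed.

Lemma LooJ f : L +oo%E f -> L +oo%E (conjf f).
Proof.
move=> /LooE[mf [M fM]]; apply/LooE; split; first exact: cmeasJ.
by exists M; apply: filterS fM => x; rewrite nsqJ.
Qed.

Lemma Loo_cst (c : C) : L +oo%E (cst c : T -> C).
Proof. by apply: (@Loo_bnd _ (nsq c)) => //; exact: cmeas_cst. Qed.

Lemma Loo1 : L +oo%E (1 : T -> C). Proof. exact: Loo_cst. Qed.

Lemma nsq_circle (z : T) : nsq (z : C) = 1.
Proof. by apply: norm1_nsq; apply/eqP; exact: circle_norm. Qed.

Lemma zJz (z : T) : (z : C) * ((z : C)^*)%C = 1.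
Proof. by rewrite -nsqE nsq_circle. Qed.

Lemma circle_conj (z : T) : ((z : C)^*)%C = (z : C)^-1.
Proof.
have z0 : (z : C) != 0.
  by apply/eqP => z0; have := zJz z; rewrite z0 mul0r => /eqP; rewrite eq_sym oner_eq0.
by rewrite -[LHS]mul1r -(mulVf z0) -mulrA zJz mulr1.
Qed.

Lemma Loo_z : L +oo%E zf.
Proof. by apply: (@Loo_bnd _ 1) => [|x]; [exact: cmeas_z|rewrite nsq_circle]. Qed.

Lemma Loo_L2 f : L +oo%E f -> L 2%:E f.
Proof.
move=> fo; have -> : f = f * 1 by rewrite mulr1.
apply: L2M => //; apply/L2E; split; first exact: cmeas_cst.
rewrite (_ : nsq \o _ = fun=> 1); first exact: intg_cst.
by apply: funext => x /=; rewrite nsq1.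
Qed.

Lemma L2Z (c : C) f : L 2%:E f -> L 2%:E (cst c * f).
Proof. by apply: L2M; exact: Loo_cst. Qed.

(** Measurability of g has to be required: it does not pass to almost
    everywhere equal functions, the Borel sigma-algebra not being complete. *)
Lemma L2_aeq f g : aeq f g -> cmeasurable g -> L 2%:E f -> L 2%:E g.
Proof.
move=> fg mg /L2E[mf fi]; apply/L2E; split => //.
apply: (intg_aele (cmeas_nsq mg) _ fi); apply: filterS fg => x /= ->.
by rewrite ger0_norm// nsq_ge0.
Qed.

Lemma Loo_aeq f g : aeq f g -> cmeasurable g -> L +oo%E f -> L +oo%E g.
Proof.
move=> fg mg /LooE[mf [M fM]]; apply/LooE; split => //; exists M.
by apply: filterS2 fg fM => x ->.
Qed.

(** * The complex integral and the inner product *)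

Definition cintg f := intg (fun x => complex.Re (f x)) /\
                      intg (fun x => complex.Im (f x)).

Lemma cintegralD f g : cintg f -> cintg g ->
  cintegral (f + g) = cintegral f + cintegral g.
Proof.
move=> [f1 f2] [g1 g2]; apply: eqC => /=; rewrite -RintegralD//;
  by apply: eq_Rintegral => x _; rewrite !ReImE.
Qed.

Lemma cintegralZ (c : C) f : cintg f -> cintegral (cst c * f) = c * cintegral f.
Proof.
move=> [f1 f2]; apply: eqC; rewrite !ReImE /= -!RintegralZl// -?RintegralB -?RintegralD//.
all: try exact: intgZ.
all: by apply: eq_Rintegral => x _; rewrite !ReImE.
Qed.

Lemma cintegralJ f : cintg f -> cintegral (conjf f) = (cintegral f)^*%C.
Proof.
move=> [f1 f2]; apply: eqC; rewrite !ReImE /=.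
  by apply: eq_Rintegral => x _; rewrite /conjf !ReImE.
rewrite -mulN1r -RintegralZl//.
by apply: eq_Rintegral => x _; rewrite /conjf !ReImE mulN1r.
Qed.

Lemma cintegral_aeq f g : cmeasurable f -> cmeasurable g -> aeq f g ->
  cintegral f = cintegral g.
Proof.
move=> [f1 f2] [g1 g2] fg; apply: eqC => /=; apply: Rint_aeq => //;
  by apply: filterS fg => x ->.
Qed.

Lemma cintgM f g : L 2%:E f -> L 2%:E g -> cintg (f * g).
Proof.
move=> /L2E[mf fi] /L2E[mg gi]; have [m1 m2] := cmeasM mf mg.
split; [apply: (intg_le m1 _ (intgD fi gi))|apply: (intg_le m2 _ (intgD fi gi))];
  move=> x; rewrite !ReImE /nsq /= ler_norml.
all: set a := complex.Re _; set b := complex.Re _.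
all: set c := complex.Im _; set d := complex.Im _.
all: have := sqr_ge0 (a - b); have := sqr_ge0 (a + b); have := sqr_ge0 (c - d).
all: have := sqr_ge0 (c + d); have := sqr_ge0 (a - d); have := sqr_ge0 (a + d).
all: have := sqr_ge0 (c - b); have := sqr_ge0 (c + b); nra.
Qed.

Lemma L2_cintg f : L 2%:E f -> cintg f.
Proof.
by move=> f2; rewrite -[f]mulr1; apply: cintgM => //; apply: Loo_L2; exact: Loo1.
Qed.

Lemma conjfM f g : conjf (f * g) = conjf f * conjf g.
Proof. by apply: funext => x; rewrite /conjf cJM. Qed.
Lemma conjfK f : conjf (conjf f) = f.
Proof. by apply: funext => x; rewrite /conjf conjcK. Qed.
Lemma fmulC f g : f * g = g * f.
Proof. by apply: funext => x; exact: mulrC. Qed.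

Lemma ipDl f g h : L 2%:E f -> L 2%:E g -> L 2%:E h ->
  inner_prod (f + g) h = inner_prod f h + inner_prod g h.
Proof.
move=> f2 g2 h2; rewrite /inner_prod mulrDl cintegralD//; apply: cintgM => //;
  exact: L2J.
Qed.

Lemma ipZl (c : C) f g : L 2%:E f -> L 2%:E g ->
  inner_prod (cst c * f) g = c * inner_prod f g.
Proof.
move=> f2 g2; rewrite /inner_prod -mulrA cintegralZ//.
by apply: cintgM => //; exact: L2J.
Qed.

Lemma ipC f g : L 2%:E f -> L 2%:E g -> inner_prod g f = (inner_prod f g)^*%C.
Proof.
move=> f2 g2; rewrite /inner_prod -cintegralJ; last by apply: cintgM => //; exact: L2J.
by rewrite conjfM conjfK fmulC.
Qed.

Lemma ipNl f g : L 2%:E f -> L 2%:E g -> inner_prod (- f) g = - inner_prod f g.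
Proof.
move=> f2 g2; have -> : - f = cst (-1) * f by apply: funext => x; exact/esym/mulN1r.
by rewrite ipZl// mulN1r.
Qed.

Lemma ipBl f g h : L 2%:E f -> L 2%:E g -> L 2%:E h ->
  inner_prod (f - g) h = inner_prod f h - inner_prod g h.
Proof. by move=> f2 g2 h2; rewrite ipDl// ?ipNl//; exact: L2N. Qed.

Lemma ipDr f g h : L 2%:E f -> L 2%:E g -> L 2%:E h ->
  inner_prod h (f + g) = inner_prod h f + inner_prod h g.
Proof.
move=> f2 g2 h2; rewrite ipC// ?ipDl// ?cJD; last exact: L2D.
by rewrite -!ipC.
Qed.

Lemma ipZr (c : C) f g : L 2%:E f -> L 2%:E g ->
  inner_prod g (cst c * f) = c^*%C * inner_prod g f.
Proof.
move=> f2 g2; rewrite ipC// ?ipZl// ?cJM; last exact: L2Z.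
by rewrite -!ipC.
Qed.

Lemma ipNr f g : L 2%:E f -> L 2%:E g -> inner_prod g (- f) = - inner_prod g f.
Proof.
move=> f2 g2; rewrite ipC// ?ipNl// ?cJN; last exact: L2N.
by rewrite -!ipC.
Qed.

Lemma ipM a f g : inner_prod (a * f) g = inner_prod f (conjf a * g).
Proof. by rewrite /inner_prod conjfM conjfK mulrA (fmulC f). Qed.

Lemma ip_aeq f f' g g' : aeq f f' -> aeq g g' -> cmeasurable f -> cmeasurable f' ->
  cmeasurable g -> cmeasurable g' -> inner_prod f g = inner_prod f' g'.
Proof.
move=> ff gg mf mf' mg mg'; apply: cintegral_aeq.
- by apply: cmeasM => //; exact: cmeasJ.
- by apply: cmeasM => //; exact: cmeasJ.
- by apply: filterS2 ff gg => x e1 e2; rewrite /conjf /GRing.mul/= e1 e2.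
Qed.

Definition nrm2 f : R := Rint (nsq \o f).

Lemma ip_nrm2 f : inner_prod f f = (nrm2 f)%:C%C.
Proof.
apply: eqC => /=; first by apply: eq_Rintegral => x _;
  rewrite -[LHS]/(complex.Re (f x * (f x)^*%C)) !ReImE /nsq /=; ring.
rewrite (_ : (fun z => _) = fun=> 0) ?Rintegral_cst//= ?mul0r//.
by apply: funext => x; rewrite -[LHS]/(complex.Im (f x * (f x)^*%C)) !ReImE; ring.
Qed.

Lemma nrm2_ge0 f : 0 <= nrm2 f.
Proof. by apply: Rintegral_ge0 => x _; exact: nsq_ge0. Qed.

Lemma nrm2_eq0 f : L 2%:E f -> nrm2 f = 0 -> aeq f 0.
Proof.
move=> /L2E[mf fi] /(Rint_eq0 fi) h.
by apply: filterS (h _) => [x /= /nsq_eq0|x]; last exact: nsq_ge0.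
Qed.

Lemma nrm2_aeq f g : cmeasurable f -> cmeasurable g -> aeq f g -> nrm2 f = nrm2 g.
Proof.
move=> mf mg fg; apply: Rint_aeq; [exact: cmeas_nsq|exact: cmeas_nsq|].
by apply: filterS fg => x /= ->.
Qed.

Lemma ip_self0 f : L 2%:E f -> inner_prod f f = 0 -> aeq f 0.
Proof.
move=> f2; rewrite ip_nrm2 => h; apply: nrm2_eq0 => //.
by move: h => /(congr1 (@complex.Re R)).
Qed.

End square_integrable.

(** * The characters z^n *)

Section fourier_coefficients.
Context {R : realType}.
Local Notation C := R[i].
Local Notation T := (circle R).
Local Notation m := (circle_measure R).
Local Notation Rint f := (Rintegral m [set: T] f).
Implicit Types f g h : T -> C.

Lemma Rint_cst (r : R) : Rint (fun=> r) = r.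
Proof. transitivity (fine (r%:E * m [set: T])%E).
  by rewrite /Rintegral integral_cst.
by rewrite [X in (_ * X)%E](@probability_setT _ _ _ m) mule1. Qed.

Definition zn (n : int) : T -> C := fun z => (z : C) ^ n.

Lemma circle_neq0 (z : T) : (z : C) != 0.
Proof.
by apply/eqP => z0; have := nsq_circle z; rewrite z0 nsq0 => /eqP; rewrite eq_sym oner_eq0.
Qed.

Lemma znD n k : zn (n + k) = zn n * zn k.
Proof. by apply: funext => z; rewrite /zn expfzDr ?circle_neq0. Qed.

Lemma zn0 : zn 0 = 1. Proof. by apply: funext => z; rewrite /zn expr0z. Qed.

Lemma zn1 : zn 1 = zf. Proof. by apply: funext => z; rewrite /zn expr1z. Qed.

Lemma zn_conj n : conjf (zn n) = zn (- n).
Proof.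
apply: funext => z; rewrite /conjf /zn.
have -> : ((z : C) ^ n)^*%C = ((z : C)^*)%C ^ n.
  by case: n => n; rewrite /exprz ?conjc_inv; [|congr (_ ^-1)]; exact: (rmorphXn (@conjc R)).
by rewrite circle_conj exprz_inv.
Qed.

Lemma znN1 : zn (-1) = conjf zf. Proof. by rewrite -zn1 zn_conj. Qed.

Lemma znK n : zn n * zn (- n) = 1.
Proof. by rewrite -znD subrr zn0. Qed.

Lemma Loo_zn n : L +oo%E (zn n).
Proof.
have pos k : L +oo%E (zn k%:Z).
  elim: k => [|k ih]; first by rewrite zn0; exact: Loo1.
  by rewrite -addn1 PoszD znD; apply: LooM => //; rewrite zn1; exact: Loo_z.
case: n => n; first exact: pos.
by rewrite NegzE -zn_conj; apply: LooJ; exact: pos.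
Qed.

Lemma cmeas_zn n : cmeasurable (zn n). Proof. exact: Loo_cmeas (Loo_zn n). Qed.

Lemma L2_zn n : L 2%:E (zn n). Proof. exact: Loo_L2 (Loo_zn n). Qed.

Lemma fourierE f n : fourier f n = inner_prod f (zn n).
Proof. by rewrite /inner_prod zn_conj. Qed.

Lemma fourier_cint f n : fourier f n = cintegral (f * zn (- n)).
Proof. by []. Qed.

Lemma expi_zn (n : int) (t : R) :
  zn n (expi t) = (cos (n%:~R * t) +i* sin (n%:~R * t))%C.
Proof.
have pos k : zn k%:Z (expi t) = (cos (k%:~R * t) +i* sin (k%:~R * t))%C.
  elim: k => [|k ih]; first by rewrite zn0 mul0r cos0 sin0.
  rewrite -addn1 PoszD znD; rewrite -[LHS]/(zn k%:Z (expi t) * zn 1 (expi t)) ih.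
  rewrite /zn expr1z intrD mulrDl mul1r cosD sinD.
  by apply: eqC; rewrite !ReImE/=; ring.
case: n => n; first exact: pos.
rewrite NegzE -zn_conj /conjf pos; apply: eqC; rewrite !ReImE /=.
  by rewrite mulrNz mulNr cosN.
by rewrite mulrNz mulNr sinN.
Qed.

(** The mean over the circle is read off a periodic primitive along t |-> e^(it). *)
Lemma Rint_expi (g : T -> R) (F : R -> R) :
  measurable_fun [set: T] g -> (forall z, `|g z| <= 1) ->
  continuous (g \o expi : R -> R) ->
  (forall t : R, is_derive t 1 F (g (expi t))) -> F (2 * pi) = F 0 ->
  Rint g = 0.
Proof.
move=> mg g1 cg dF FE.
have p2 := @ltr0_2pi R.
have ig : intg g.
  by apply: (intg_le mg _ (intg_cst 1)).
have i1g : intg (fun z => 1 + g z) by exact: (intgD (intg_cst 1) ig).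
(* The change of variables formula is for nonnegative integrands, hence the
   added 1. *)
suff : Rint (fun z => 1 + g z) = 1.
  rewrite RintegralD//; last exact: intg_cst.
  rewrite Rint_cst => h.
  by apply: (addrI 1); rewrite h addr0.
have mh : measurable_fun [set: T] (EFin \o (fun z => 1 + g z)).
  exact/measurable_EFinP/intg_meas.
have mhe : measurable_fun [set: measurableTypeR R] ((EFin \o (fun z => 1 + g z)) \o expi).
  by apply: measurableT_comp => //; exact: measurable_expi.
have h0 (x : measurableTypeR R) : (0 <= ((EFin \o (fun z => (1 + g z)%R)) \o expi) x)%E.
  by rewrite /= lee_fin; have := g1 (expi x); rewrite ler_norml => /andP[]; lra.
rewrite /Rintegral /circle_measure.
rewrite ge0_integral_distribution//; last first.
  by move=> z; rewrite /= lee_fin; have := g1 z; rewrite ler_norml => /andP[]; lra.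
rewrite integral_uniform//.
have -> : (\int[lebesgue_measure]_(x in `[0%R, (2 * pi)%R])
   ((EFin \o (fun z : T => (1 + g z)%R)) \o expi) x)%E = (2 * pi)%:E.
  have FTC := @continuous_FTC2 R (fun t => 1 + g (expi t)) (fun t => t + F t) 0 (2 * pi) p2.
  have D (t : R) : is_derive t 1 (fun t => t + F t) (1 + g (expi t)).
    by apply: is_deriveD.
  have cont : continuous (fun t => t + F t).
    by move=> t; apply/differentiable_continuous/derivable1_diffP; case: (D t).
  rewrite [LHS]FTC.
  - by rewrite -EFinB FE; congr EFin; ring.
  - apply: continuous_subspaceT => t.
    by apply: cvgD; [exact: cvg_cst|exact: cg].
  - split.
    + by move=> t _; case: (D t).
    + by apply: cvg_at_right_filter; exact: cont.
    + by apply: cvg_at_left_filter; exact: cont.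
  - by move=> t _; rewrite derive1E; case: (D t).
by rewrite subr0 -EFinM/= mulVf// gt_eqF.
Qed.

Lemma cintegral_zn n : n != 0 -> cintegral (zn n) = 0.
Proof.
move=> n0; have nR0 : (n%:~R : R) != 0 by rewrite intr_eq0.
have e2pi : zn n (expi (2 * pi)) = 1.
  rewrite /zn (_ : (expi (2 * pi) : C) = 1) ?exp1rz//.
  by apply: eqC => /=; rewrite mulr_natl ?cos2pi ?sin2pi.
move: e2pi; rewrite expi_zn => -[cE sE].
have [m1 m2] := cmeas_zn n.
have bnd (z : T) : `|complex.Re (zn n z)| <= 1 /\ `|complex.Im (zn n z)| <= 1.
  have : nsq (zn n z) = 1.
    apply: (@complexI R); rewrite nsqE -[_^*%C]/(conjf (zn n) z) zn_conj.
    exact: (congr1 (fun f => f z) (znK n)).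
  rewrite /nsq => h; have := sqr_ge0 (complex.Re (zn n z)).
  have := sqr_ge0 (complex.Im (zn n z)).
  split; rewrite -[leRHS]normr1 -ler_sqr ?nnegrE// ?real_normK ?num_real//; lra.
have cl : continuous (fun t : R => n%:~R * t) by move=> t; exact: mulrl_continuous.
have dl (t : R) : is_derive t 1 (fun t : R => n%:~R * t) n%:~R.
  by apply: is_derive_eq; rewrite /GRing.scale/= mulr1.
apply: eqC.
- apply: (@Rint_expi _ (fun t => n%:~R^-1 * sin (n%:~R * t))) => //.
  + by move=> z; case: (bnd z).
  + rewrite /comp; under eq_fun do rewrite expi_zn.
    by move=> t; apply: continuous_comp; [exact: cl|exact: continuous_cos].
  + move=> t; rewrite expi_zn /=.
    have := is_derive1_comp (is_derive_sin (n%:~R * t)) (dl t) => D.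
    have -> : cos (n%:~R * t) = n%:~R^-1 *: (cos (n%:~R * t) * n%:~R).
      by rewrite /GRing.scale/=; field.
    exact: (@is_deriveZ _ _ _ _ n%:~R^-1 _ _ _ D).
  + by rewrite sE (mulr0 n%:~R) sin0.
- apply: (@Rint_expi _ (fun t => - (n%:~R^-1 * cos (n%:~R * t)))) => //.
  + by move=> z; case: (bnd z).
  + rewrite /comp; under eq_fun do rewrite expi_zn.
    by move=> t; apply: continuous_comp; [exact: cl|exact: continuous_sin].
  + move=> t; rewrite expi_zn /=.
    have := is_derive1_comp (is_derive_cos (n%:~R * t)) (dl t) => D.
    have -> : sin (n%:~R * t) = - (n%:~R^-1 *: (- sin (n%:~R * t) * n%:~R)).
      by rewrite /GRing.scale/=; field.
    exact: (is_deriveN (@is_deriveZ _ _ _ _ n%:~R^-1 _ _ _ D)).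
  + by rewrite cE (mulr0 n%:~R) cos0.
Qed.

Lemma cintegral1 : cintegral (1 : T -> C) = 1.
Proof.
by apply: eqC => /=; exact: Rint_cst.
Qed.

End fourier_coefficients.

(** * Moments and indicators *)

Section fourier_uniqueness.
Context {R : realType}.
Local Notation C := R[i].
Local Notation T := (circle R).
Local Notation m := (circle_measure R).
Local Notation Rint f := (Rintegral m [set: T] f).
Implicit Types f g h : T -> C.

Lemma RintZ (r : R) (f : T -> R) : intg f -> Rint (fun x => r * f x) = r * Rint f.
Proof. by move=> fi; rewrite RintegralZl. Qed.

Lemma Rint_dct (h_ : nat -> T -> R) (h G : T -> R) :
  (forall n, measurable_fun [set: T] (h_ n)) -> intg G ->
  (forall n x, `|h_ n x| <= G x) ->
  (forall x, h_ n x @[n --> \oo] --> h x) ->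
  intg h /\ Rint (h_ n) @[n --> \oo] --> Rint h.
Proof.
move=> mh iG hG hh.
have mh0 : measurable_fun [set: T] h.
  by apply: (measurable_fun_cvg (h := h_)) => // x _; exact: hh.
have ih : intg h.
  apply: (intg_le mh0 _ iG) => x.
  apply: (closed_cvg (fun y => y <= G x) (@closed_le _ _) _ _ (cvg_norm (hh x))).
  by apply: nearW => n; exact: hG.
split => //.
have hE x : (h_ n x)%:E @[n --> \oo] --> (h x)%:E.
  by apply: cvg_EFin; [exact: nearW|exact: hh].
have [_ _] := @dominated_convergence _ _ _ m [set: T] measurableT
  (fun n => EFin \o h_ n) (EFin \o h) (EFin \o G)
  (fun n => proj2 (measurable_EFinP _ _) (mh n))
  (proj2 (measurable_EFinP _ _) mh0)
  (aeW _ (fun x _ => hE x)) iG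
  (aeW _ (fun x n _ => hG n x)).
have F : (\int[m]_x (EFin \o h) x)%E \is a fin_num by exact: integrable_fin_num.
by rewrite -(fineK F) => /fine_cvg.
Qed.

Lemma bernoulli_ge (x : R) n : 0 <= x <= 1 -> 1 - n%:R * x <= (1 - x) ^+ n.
Proof.
move=> /andP[x0 x1]; elim: n => [|n ih]; first by rewrite mul0r subr0 expr0.
have n0 : 0 <= n%:R * x ^+ 2 by rewrite mulr_ge0 ?sqr_ge0.
rewrite exprS; apply: le_trans (ler_wpM2l _ ih); last by rewrite subr_ge0.
by rewrite -natr1; nra.
Qed.

Lemma bernoulli_le (x : R) n : 0 <= x <= 1 ->
  (1 - x) ^+ n * (1 + n%:R * x) <= 1.
Proof.
move=> /andP[x0 x1]; elim: n => [|n ih]; first by rewrite mul0r addr0 expr0 mulr1.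
apply: le_trans ih; rewrite exprSr -mulrA ler_wpM2l ?exprn_ge0 ?subr_ge0//.
have n0 : 0 <= n%:R * x ^+ 2 by rewrite mulr_ge0 ?sqr_ge0.
have := sqr_ge0 x.
by rewrite -natr1; nra.
Qed.

Lemma cvg_nat_expr (r : R) : 0 <= r < 1 -> n.+1%:R * r ^+ n @[n --> \oo] --> 0.
Proof.
move=> /andP[r0 r1]; set s := Num.sqrt r.
have s0 : 0 <= s by exact: sqrtr_ge0.
have s1 : s < 1 by rewrite /s -sqrtr1 ltr_sqrt.
have sr : r = s ^+ 2 by rewrite sqr_sqrtr.
have b n : n.+1%:R * s ^+ n * (1 - s) <= 1 - s ^+ n.+1.
  elim: n => [|n ih]; first by rewrite expr0 expr1 mulr1 mul1r.
  have sn : s ^+ n.+1 <= s ^+ n by rewrite exprS; apply: ler_piMl; [exact: exprn_ge0|exact: ltW].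
  have sn0 : 0 <= s ^+ n.+1 by rewrite exprn_ge0.
  have h : n.+1%:R * s ^+ n.+1 * (1 - s) <= n.+1%:R * s ^+ n * (1 - s).
    by apply: ler_wpM2r; [rewrite subr_ge0 ltW|exact: ler_wpM2l].
  rewrite -natr1 mulrDl mul1r mulrDl (exprS s n.+1); lra.
apply: (@squeeze_cvgr _ _ _ _ (cst 0) (geometric (1 - s)^-1 s)).
- apply: nearW => n; rewrite /= mulr_ge0 ?exprn_ge0//=.
  have -> : n.+1%:R * r ^+ n = (n.+1%:R * s ^+ n) * s ^+ n.
    by rewrite sr -exprM mulnC exprM expr2; ring.
  rewrite ler_wpM2r ?exprn_ge0// -(ler_pM2r (_ : 0 < 1 - s)) ?subr_gt0//.
  rewrite mulVf ?gt_eqF ?subr_gt0//; apply: (le_trans (b n)).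
  by rewrite gerBl exprn_ge0.
- exact: cvg_cst.
- by apply: cvg_geometric; rewrite ger0_norm.
Qed.

(** Polynomials that stay in [0, 1] on [0, 1] and converge there to the indicator
    of u < 1/2. The exponent K = (n + 1) 2^n is such that K u^n tends to 0 below
    1/2 and is at least n + 1 from 1/2 on; the two Bernoulli inequalities
    conclude. *)
Lemma cvg_step (u : R) : 0 <= u <= 1 ->
  (1 - u ^+ n) ^+ (n.+1 * 2 ^ n) @[n --> \oo] --> ((u < 2^-1)%R%:R : R).
Proof.
move=> /andP[u0 u1].
have un n : 0 <= u ^+ n <= 1 by rewrite exprn_ge0//= exprn_ile1.
have v0 n : 0 <= 1 - u ^+ n by rewrite subr_ge0; case/andP: (un n).
have KE n : (n.+1 * 2 ^ n)%:R * u ^+ n = n.+1%:R * (2 * u) ^+ n.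
  by rewrite natrM natrX exprMn mulrA.
have [uh|uh] := ltrP u 2^-1.
- apply: (@squeeze_cvgr _ _ _ _ (fun n => 1 - n.+1%:R * (2 * u) ^+ n) (cst 1)).
  + apply: nearW => n; rewrite -KE bernoulli_ge//=.
    by rewrite exprn_ile1// gerBl; case/andP: (un n).
  + rewrite -[X in _ --> X]subr0; apply: cvgB; first exact: cvg_cst.
    by apply: cvg_nat_expr; lra.
  + exact: cvg_cst.
- apply: (@squeeze_cvgr _ _ _ _ (cst 0) (fun n => n.+1%:R^-1)).
  + apply: nearW => n; rewrite exprn_ge0//=.
    have := bernoulli_le (n.+1 * 2 ^ n) (un n); rewrite KE.
    have h1 : 1 <= (2 * u) ^+ n by rewrite exprn_ege1//; lra.
    have h2 : n.+1%:R <= 1 + n.+1%:R * (2 * u) ^+ n :> R.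
      have : n.+1%:R <= n.+1%:R * (2 * u) ^+ n :> R by rewrite ler_peMr.
      lra.
    move=> h; rewrite -[leRHS]mul1r ler_pdivlMr//; apply: le_trans h.
    by apply: ler_wpM2l => //; exact: exprn_ge0.
  + exact: cvg_cst.
  + exact: cvg_harmonic.
Qed.

Lemma intgMb (f g : T -> R) (M : R) : intg f -> measurable_fun [set: T] g ->
  (forall x, `|g x| <= M) -> intg (fun x => f x * g x).
Proof.
move=> fi mg gM.
have mf := intg_meas fi.
apply: (intg_le (g := fun x => M * `|f x|)).
- exact: measurable_funM.
- by move=> x; rewrite normrM mulrC ler_wpM2r.
- by apply: intgZ; exact: integrable_norm.
Qed.

Section moments.
Variables (f W : T -> R).
Hypotheses (fi : intg f) (mW : measurable_fun [set: T] W).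
Hypothesis W1 : forall x, `|W x| <= 1.
Hypothesis fW0 : forall k, Rint (fun x => f x * W x ^+ k) = 0.

Lemma moments_poly (p : {poly R}) : Rint (fun x => f x * p.[W x]) = 0.
Proof.
have Wk k : intg (fun x => f x * W x ^+ k).
  apply: (@intgMb _ _ 1) => //; first exact: measurable_funX.
  by move=> x; rewrite normrX exprn_ile1.
suff H k : intg (fun x => f x * W x ^+ k * p.[W x]) /\
    Rint (fun x => f x * W x ^+ k * p.[W x]) = 0.
  have [_ <-] := H 0%N; apply: eq_Rintegral => x _.
  by rewrite expr0 mulr1.
elim/poly_ind: p k => [k|p c ih k].
  have -> : (fun x => f x * W x ^+ k * (0 : {poly R}).[W x]) = fun=> 0.
    by apply: funext => x; rewrite horner0 mulr0.
  by split; [exact: intg_cst|exact: Rint_cst].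
have [i1 z1] := ih k.+1.
have -> : (fun x => f x * W x ^+ k * (p * 'X + c%:P).[W x]) =
  (fun x => f x * W x ^+ k.+1 * p.[W x]) \+ (fun x => c * (f x * W x ^+ k)).
  by apply: funext => x; rewrite !hornerE/= exprS; ring.
split; first by apply: intgD => //; exact: intgZ.
have zc : Rint (fun x => c * (f x * W x ^+ k)) = 0.
  transitivity (c * Rint (fun x => f x * W x ^+ k)).
    exact: RintZ.
  by rewrite (fW0 k) mulr0.
by have := RintegralD measurableT i1 (intgZ c (Wk k)); rewrite z1 zc addr0.
Qed.

(** If f has vanishing moments against the bounded function W, dominated
    convergence along the polynomials of cvg_step, rescaled so that the threshold
    is at W = c, gives a vanishing integral over each set W < c. *)
Lemma moments_ray (c : R) : Rint (fun x => f x * (W x < c)%R%:R) = 0.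
Proof.
set a : R := (4 * (1 + `|c|))^-1.
have c0 : 0 <= `|c| by [].
have a0 : 0 < a by rewrite invr_gt0; lra.
have aE : a * (4 * (1 + `|c|)) = 1 by rewrite mulVf// gt_eqF//; lra.
(* As |W - c| <= 1 + |c|, the factor a keeps the argument within 1/4 of 1/2. *)
have u01 x : 0 <= 2^-1 + a * (W x - c) <= 1.
  have : `|W x - c| <= 1 + `|c|.
    by apply: (le_trans (ler_normB _ _)); rewrite lerD2r.
  rewrite ler_norml => /andP[h1 h2].
  have e1 : a * - (1 + `|c|) <= a * (W x - c) by rewrite ler_wpM2l// ltW.
  have e2 : a * (W x - c) <= a * (1 + `|c|) by rewrite ler_wpM2l// ltW.
  by apply/andP; split; nra.
pose p n : {poly R} := (1 - ((2^-1 - a * c)%:P + a%:P * 'X) ^+ n) ^+ (n.+1 * 2 ^ n).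
have pE n w : (p n).[w] = (1 - (2^-1 + a * (w - c)) ^+ n) ^+ (n.+1 * 2 ^ n).
  rewrite /p !hornerE; congr ((1 - _ ^+ _) ^+ _); ring.
have mp n : measurable_fun [set: T] (fun x => (p n).[W x]).
  under eq_fun do rewrite pE.
  apply/measurable_funX/measurable_funB => //; apply: measurable_funX.
  by apply: measurable_funD => //; apply: measurable_funM => //; exact: measurable_funB.
have p1 n x : `|(p n).[W x]| <= 1.
  have /andP[h0 h1] := u01 x.
  have l0 : 0 <= 1 - (2^-1 + a * (W x - c)) ^+ n by rewrite subr_ge0 exprn_ile1.
  rewrite pE ger0_norm ?exprn_ge0// exprn_ile1// gerBl exprn_ge0//.
have mf := intg_meas fi.
have [] := @Rint_dct (fun n x => f x * (p n).[W x])
   (fun x => f x * (W x < c)%R%:R) (fun x => `|f x|).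
- by move=> n; exact: measurable_funM.
- exact: integrable_norm.
- by move=> n x; rewrite normrM ler_piMr.
- move=> x; apply: cvgM; first exact: cvg_cst.
  under eq_fun do rewrite pE.
  have -> : (W x < c) = (2^-1 + a * (W x - c) < 2^-1).
    by rewrite gtrDl pmulr_rlt0// subr_lt0.
  exact: cvg_step.
- move=> _; under eq_fun do rewrite moments_poly.
  by move=> h; exact: (@cvg_unique _ (@Rhausdorff R) _ _ _ _ h (cvg_cst 0)).
Qed.

End moments.

Lemma integral_indic (f : T -> R) (D : set T) : measurable D -> intg f ->
  (\int[m]_(x in D) (f x)%:E = (Rint (fun x => f x * \1_D x))%:E)%E.
Proof.
move=> mD fi; rewrite integral_mkcond restrict_EFin /Rintegral fineK.
  apply: eq_integral => x _ /=; congr EFin; rewrite patchE indicE.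
  by case: ifP => _; rewrite ?mulr1 ?mulr0.
apply: integrable_fin_num => //; apply: (@intgMb _ _ 1) => //.
by move=> x; rewrite indicE; case: (_ \in _); rewrite ?normr1 ?normr0.
Qed.

(** The sets over which f has integral zero are closed under complements and
    disjoint unions, so that a generating pi-system suffices. *)
Lemma vanish_dynkin d (U : measurableType d) (W : T -> U) (G : set (set U))
    (f : T -> R) :
  measurable_fun [set: T] W -> @measurable _ U = <<s G >> -> setI_closed G ->
  intg f -> Rint f = 0 ->
  (forall A, G A -> Rint (fun x => f x * \1_(W @^-1` A) x) = 0) ->
  forall A, measurable A -> Rint (fun x => f x * \1_(W @^-1` A) x) = 0.
Proof.
move=> mW UG GI fi f0 fG A mA.
have mWA B : measurable B -> measurable (W @^-1` B).
  by move=> mB; rewrite -[X in measurable X]setTI; exact: mW.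
pose P B := measurable B -> (\int[m]_(x in W @^-1` B) (f x)%:E = 0)%E.
suff : P A by move=> /(_ mA); rewrite integral_indic//; [case|exact: mWA].
move: mA; rewrite /measurable/= -/(measurable A) => mA.
have : <<s G >> A by rewrite -UG.
apply: (@dynkin_induction _ U G P) => //.
- move=> _; rewrite preimage_setT integral_indic//; congr EFin.
  by rewrite -[RHS]f0; apply: eq_Rintegral => x _; rewrite indicT mulr1.
- by move=> B GB mB; rewrite integral_indic ?fG//; exact: mWA.
- move=> B mB PB mCB; rewrite preimage_setC.
  have := PB mB.
  have : (\int[m]_(x in W @^-1` B `|` ~` (W @^-1` B)) (f x)%:E = 0)%E.
    rewrite setUv integral_indic//; congr EFin.
    by rewrite -[RHS]f0; apply: eq_Rintegral => x _; rewrite indicT mulr1.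
  rewrite integral_setU//.
  + by move=> + h; rewrite h add0e.
  + exact: mWA.
  + by apply: measurableC; exact: mWA.
  + by rewrite setUv; exact: measurable_int fi.
  + by rewrite disj_set2E setICr.
- move=> F mF tF PF mUF; rewrite preimage_bigcup integral_bigcup//.
  + by apply: eseries0 => i _ _; exact: PF.
  + apply/trivIsetP => i j _ _ ij; rewrite -preimage_setI.
    by move/trivIsetP : tF => -> //; rewrite preimage_set0.
  + by move=> k; exact: mWA.
  + apply: integrableS fi => //; apply: bigcup_measurable => k _; exact: mWA.
Qed.

End fourier_uniqueness.

(** * Uniqueness of Fourier coefficients *)

Section fourier_uniqueness_L2.
Context {R : realType}.
Local Notation C := R[i].
Local Notation T := (circle R).
Local Notation m := (circle_measure R).
Local Notation Rint f := (Rintegral m [set: T] f).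
Implicit Types f g h : T -> C.

Lemma fourierD f g n : L 2%:E f -> L 2%:E g ->
  fourier (f + g) n = fourier f n + fourier g n.
Proof. by move=> f2 g2; rewrite !fourierE ipDl//; exact: L2_zn. Qed.

Lemma fourierZ c f n : L 2%:E f -> fourier (cst c * f) n = c * fourier f n.
Proof. by move=> f2; rewrite !fourierE ipZl//; exact: L2_zn. Qed.

Lemma fourierN f n : L 2%:E f -> fourier (- f) n = - fourier f n.
Proof. by move=> f2; rewrite !fourierE ipNl//; exact: L2_zn. Qed.

Lemma fourierB f g n : L 2%:E f -> L 2%:E g ->
  fourier (f - g) n = fourier f n - fourier g n.
Proof. by move=> f2 g2; rewrite !fourierE ipBl//; exact: L2_zn. Qed.

Lemma fourier_shift f k n : fourier (zn k * f) n = fourier f (n - k).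
Proof.
by rewrite !fourier_cint (fmulC (zn k)) -mulrA -znD; congr (cintegral (_ * zn _)); ring.
Qed.

Lemma fourier_aeq f g n : cmeasurable f -> cmeasurable g -> aeq f g ->
  fourier f n = fourier g n.
Proof.
move=> mf mg fg; rewrite !fourierE; apply: ip_aeq => //; try exact: cmeas_zn.
exact: aeq_refl.
Qed.

Lemma fourier_conj f n : L 2%:E f -> fourier (conjf f) n = (fourier f (- n))^*%C.
Proof.
move=> f2; rewrite !fourierE -(ipC f2 (L2_zn _)) /inner_prod.
by rewrite fmulC zn_conj.
Qed.

Lemma fourier_zn k n : fourier (zn k : T -> C) n = (n == k)%:R.
Proof.
rewrite fourier_cint -znD; have [->|nk] := eqVneq n k.
  by rewrite subrr zn0 cintegral1.
by rewrite cintegral_zn// subr_eq0 eq_sym.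
Qed.

Let Z f := L 2%:E f /\ forall n, fourier f n = 0.

Let Z_zn k f : Z f -> Z (zn k * f).
Proof.
move=> [f2 f0]; split; first by apply: L2M => //; exact: Loo_zn.
by move=> n; rewrite fourier_shift.
Qed.

Let ZD f g : Z f -> Z g -> Z (f + g).
Proof.
move=> [f2 f0] [g2 g0]; split; first exact: L2D.
by move=> n; rewrite fourierD// f0 g0 addr0.
Qed.

Let ZZ c f : Z f -> Z (cst c * f).
Proof.
move=> [f2 f0]; split; first exact: L2Z.
by move=> n; rewrite fourierZ// f0 mulr0.
Qed.

Definition toCf (W : T -> R) : T -> C := fun z => (W z)%:C%C.

Let Z_Re f : Z f -> Z (toCf (fun z : T => complex.Re (z : C)) * f).
Proof.
move=> Zf; have -> : toCf (fun z : T => complex.Re (z : C)) * f =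
    cst (2^-1)%:C%C * (zn 1 * f + zn (-1) * f).
  apply: funext => z; rewrite zn1 znN1.
  rewrite -[LHS]/((complex.Re (z : C))%:C%C * f z).
  rewrite -[RHS]/((2^-1)%:C%C * ((z : C) * f z + ((z : C)^*)%C * f z)).
  by apply: eqC; rewrite !ReImE /=; field.
by apply: ZZ; apply: ZD; exact: Z_zn.
Qed.

Let Z_Im f : Z f -> Z (toCf (fun z : T => complex.Im (z : C)) * f).
Proof.
move=> Zf; have -> : toCf (fun z : T => complex.Im (z : C)) * f =
    cst (0 -i* 2^-1)%C * (zn 1 * f + cst (-1) * (zn (-1) * f)).
  apply: funext => z; rewrite zn1 znN1.
  rewrite -[LHS]/((complex.Im (z : C))%:C%C * f z).
  rewrite -[RHS]/((0 -i* 2^-1)%C * ((z : C) * f z + (-1) * (((z : C)^*)%C * f z))).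
  by apply: eqC; rewrite !ReImE /=; field.
by apply: ZZ; apply: ZD; [exact: Z_zn|apply/ZZ/Z_zn].
Qed.

Lemma setIray : setI_closed (@RGenInftyO.G R).
Proof.
move=> _ _ [a ->] [b ->]; exists (Num.min a b).
by apply/seteqP; split => x /=; rewrite !in_itv/= lt_min => /andP.
Qed.

Lemma cmeas_toCf (W : T -> R) : measurable_fun [set: T] W -> cmeasurable (toCf W).
Proof. by move=> mW; split => //=; exact: measurable_cst. Qed.

Lemma Loo_toCf (W : T -> R) : measurable_fun [set: T] W ->
  (forall x, `|W x| <= 1) -> L +oo%E (toCf W).
Proof.
move=> mW W1; apply: (@Loo_bnd _ _ 1); first exact: cmeas_toCf.
move=> x; rewrite /nsq /= expr0n addr0 -[_ ^+ 2]ger0_norm ?sqr_ge0// normrX.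
by rewrite exprn_ile1.
Qed.

Lemma Re_toCf (W : T -> R) f (z : T) :
  complex.Re ((toCf W * f) z) = complex.Re (f z) * W z.
Proof. by rewrite -[(_ * _) z]/(toCf W z * f z) ReM /= mul0r subr0 mulrC. Qed.

Lemma Im_toCf (W : T -> R) f (z : T) :
  complex.Im ((toCf W * f) z) = complex.Im (f z) * W z.
Proof. by rewrite -[(_ * _) z]/(toCf W z * f z) ImM /= mul0r addr0 mulrC. Qed.

Let Z_indic (W : T -> R) (A : set R) f : measurable_fun [set: T] W ->
  (forall x, `|W x| <= 1) -> (forall g, Z g -> Z (toCf W * g)) ->
  measurable A -> Z f -> Z (toCf (\1_(W @^-1` A)) * f).
Proof.
move=> mW W1 ZW mA [f2 f0].
have mWA : measurable (W @^-1` A) by rewrite -[X in measurable X]setTI; exact: mW.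
have m1 : measurable_fun [set: T] (\1_(W @^-1` A) : T -> R) by [].
split.
  apply: L2M => //; apply: Loo_toCf => // x.
  by rewrite indicE; case: (_ \in _); rewrite ?normr1 ?normr0.
move=> n; rewrite fourier_cint -mulrA (fmulC f).
have Zg : Z (zn (- n) * f) by exact: Z_zn.
move: (zn (- n) * f) Zg => g Zg.
have Zk k : Z (toCf (fun z => W z ^+ k) * g).
  elim: k => [|k ih].
    by have -> : toCf (fun z => W z ^+ 0) * g = g by apply: funext => z; exact: mul1r.
  have -> : toCf (fun z => W z ^+ k.+1) * g = toCf W * (toCf (fun z => W z ^+ k) * g).
    apply: funext => z; rewrite -[LHS]/((W z ^+ k.+1)%:C%C * g z).
    rewrite -[RHS]/((W z)%:C%C * ((W z ^+ k)%:C%C * g z)) mulrA -rmorphM/=.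
    by rewrite exprS.
  exact: ZW.
have [gi1 gi2] := L2_cintg (proj1 Zg).
have ck k : cintegral (toCf (fun z => W z ^+ k) * g) = 0.
  by have [_ /(_ 0)] := Zk k; rewrite fourier_cint oppr0 zn0 mulr1.
have r0 k : Rint (fun x => complex.Re (g x) * W x ^+ k) = 0.
  rewrite -[RHS](congr1 (@complex.Re R) (ck k)).
  by apply: eq_Rintegral => x _; rewrite Re_toCf.
have i0 k : Rint (fun x => complex.Im (g x) * W x ^+ k) = 0.
  rewrite -[RHS](congr1 (@complex.Im R) (ck k)).
  by apply: eq_Rintegral => x _; rewrite Im_toCf.
have ray (h : T -> R) : intg h -> (forall k, Rint (fun x => h x * W x ^+ k) = 0) ->
    Rint (fun x => h x * \1_(W @^-1` A) x) = 0.
  move=> hi h0; apply: (@vanish_dynkin _ _ _ W (@RGenInftyO.G R)) => //.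
  - exact: RGenInftyO.measurableE.
  - exact: setIray.
  - by rewrite -[RHS](h0 0%N); apply: eq_Rintegral => x _; rewrite expr0 mulr1.
  - move=> _ [c ->].
    rewrite -[RHS](moments_ray hi mW W1 h0 c); apply: eq_Rintegral => x _.
    congr (_ * _); rewrite indicE; congr (_ %:R); congr nat_of_bool.
    by apply/idP/idP; rewrite inE /= in_itv.
apply: eqC => /=.
- rewrite -[RHS](ray _ gi1 r0); apply: eq_Rintegral => x _; exact: Re_toCf.
- rewrite -[RHS](ray _ gi2 i0); apply: eq_Rintegral => x _; exact: Im_toCf.
Qed.

Lemma abs_coord (z : T) : `|complex.Re (z : C)| <= 1 /\ `|complex.Im (z : C)| <= 1.
Proof.
have := nsq_circle z; rewrite /nsq => h.
have := sqr_ge0 (complex.Re (z : C)); have := sqr_ge0 (complex.Im (z : C)).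
by split; rewrite -[leRHS]normr1 -ler_sqr ?nnegrE// ?real_normK ?num_real//; lra.
Qed.

Lemma Rint_vanish_ae (h : T -> R) : intg h ->
  (forall E, measurable E -> Rint (fun x => h x * \1_E x) = 0) ->
  \forall x \ae m, h x = 0.
Proof.
move=> hi h0.
have : ae_eq m [set: T] (EFin \o h) (cst 0%E).
  apply: integral_ae_eq => // E _ mE.
  by rewrite (integral_indic mE hi) h0// integral0.
by apply: filterS => x /(_ I) [].
Qed.

(** Vanishing coefficients are inherited by the products of f with polynomials in
    Re z and Im z, hence, by bounded convergence, with indicators of half-planes,
    hence, by the pi-lambda theorem, with indicators of all Borel sets. *)
Theorem fourier_inj f : L 2%:E f -> (forall n, fourier f n = 0) -> aeq f 0.
Proof.
move=> f2 f0.
have [mX mY] := @cmeas_z R.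
have Zf : Z f by [].
have ZAB (A B : set R) : measurable A -> measurable B ->
    cintegral (toCf (\1_(@circle_coord R @^-1` (A `*` B))) * f) = 0.
  move=> mA mB.
  have := Z_indic mX (fun x => proj1 (abs_coord x)) Z_Re mA
    (Z_indic mY (fun x => proj2 (abs_coord x)) Z_Im mB Zf).
  move=> [_ /(_ 0)]; rewrite fourier_cint oppr0 zn0 mulr1 mulrA => h.
  rewrite -[RHS]h; congr (cintegral (_ * _)); apply: funext => z.
  rewrite -[RHS]/((\1_((fun z : T => complex.Re (z : C)) @^-1` A) z)%:C%C *
     (\1_((fun z : T => complex.Im (z : C)) @^-1` B) z)%:C%C).
  rewrite -rmorphM /toCf; congr (_ %:C)%C; rewrite /= !indicE -natrM mulnb.
  congr (_ %:R); congr nat_of_bool; apply/idP/andP; rewrite !inE.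
    by move=> [].
  by move=> [].
have [fi1 fi2] := L2_cintg f2.
have c0 : cintegral f = 0 by have := f0 0; rewrite fourier_cint oppr0 zn0 mulr1.
have key (h : T -> R) : intg h -> Rint h = 0 ->
    (forall A B, measurable A -> measurable B ->
       Rint (fun x => h x * \1_(@circle_coord R @^-1` (A `*` B)) x) = 0) ->
    \forall x \ae m, h x = 0.
  move=> hi h0 hAB; apply: Rint_vanish_ae => // E [B mB <-]; rewrite setTI.
  apply: (@vanish_dynkin _ _ _ (@circle_coord R)
    [set A `*` B | A in measurable & B in measurable]) => //.
  - exact: measurable_coord.
  - exact: measurable_prod_measurableType.
  - move=> _ _ [X1 mX1 [X2 mX2 <-]] [Y1 mY1 [Y2 mY2 <-]].
    exists (X1 `&` Y1); first exact: measurableI.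
    exists (X2 `&` Y2); first exact: measurableI.
    by rewrite setXI.
  - by move=> _ [X1 mX1 [X2 mX2 <-]]; exact: hAB.
have re0 : \forall x \ae m, complex.Re (f x) = 0.
  apply: key => //; first exact: (congr1 (@complex.Re R) c0).
  move=> A B mA mB; rewrite -[RHS](congr1 (@complex.Re R) (ZAB A B mA mB)).
  by apply: eq_Rintegral => x _; rewrite Re_toCf.
have im0 : \forall x \ae m, complex.Im (f x) = 0.
  apply: key => //; first exact: (congr1 (@complex.Im R) c0).
  move=> A B mA mB; rewrite -[RHS](congr1 (@complex.Im R) (ZAB A B mA mB)).
  by apply: eq_Rintegral => x _; rewrite Im_toCf.
by apply: filterS2 re0 im0 => x r i; exact: eqC.
Qed.

End fourier_uniqueness_L2.

(** * Orthogonal projections *)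

Section orthogonal_projection.
Context {R : realType}.
Local Notation C := R[i].
Local Notation T := (circle R).
Local Notation m := (circle_measure R).
Local Notation Rint f := (Rintegral m [set: T] f).
Implicit Types f g h : T -> C.

Lemma geometric_increments (u : nat -> R) (c q : R) : 0 <= q < 1 ->
  (forall n, `|u n.+1 - u n| <= c * q ^+ n) ->
  cvgn u /\ forall n, `|u n - u 0%N| <= c / (1 - q).
Proof.
move=> /andP[q0 q1] uc.
have c0 : 0 <= c by have := uc 0%N; rewrite expr0 mulr1; exact: le_trans.
have q10 : 0 < 1 - q by rewrite subr_gt0.
split; last first.
  move=> n; rewrite ler_pdivlMr//.
  apply: (@le_trans _ _ (c * (1 - q ^+ n))); last first.
    by rewrite ler_piMr// gerBl exprn_ge0.
  elim: n => [|n ih]; first by rewrite subrr normr0 mul0r expr0 subrr mulr0.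
  have -> : u n.+1 - u 0%N = (u n.+1 - u n) + (u n - u 0%N) by ring.
  apply: (@le_trans _ _ ((`|u n.+1 - u n| + `|u n - u 0%N|) * (1 - q))).
    by rewrite ler_wpM2r ?ler_normD// ltW.
  rewrite mulrDl; have h1 : `|u n.+1 - u n| * (1 - q) <= c * q ^+ n * (1 - q).
    by apply: ler_wpM2r => //; exact: ltW.
  by rewrite exprS; lra.
have -> : u = (fun n => u 0%N + series (telescope u) n).
  by apply: funext => n; exact: eq_sum_telescope.
apply: is_cvgD; first exact: is_cvg_cst.
apply: normed_cvg; apply: (@series_le_cvg _ _ (geometric c q)).
- by move=> n; rewrite /=.
- by move=> n; rewrite /= mulr_ge0// exprn_ge0.
- by move=> n; exact: uc.
- by apply: is_cvg_geometric_series; rewrite ger0_norm.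
Qed.

Lemma nrm2D f g : L 2%:E f -> L 2%:E g ->
  nrm2 (f + g) = nrm2 f + nrm2 g + 2 * complex.Re (inner_prod f g).
Proof.
move=> f2 g2.
suff : ((nrm2 (f + g))%:C = (nrm2 f + nrm2 g + 2 * complex.Re (inner_prod f g))%:C)%C.
  by case.
have fg := L2D f2 g2.
rewrite -ip_nrm2 ipDl// !ipDr// !ip_nrm2 (ipC f2 g2).
by apply: eqC; rewrite !ReImE /=; ring.
Qed.

Lemma nrm2N f : nrm2 (- f) = nrm2 f.
Proof. by apply: eq_Rintegral => x _ /=; rewrite nsqN. Qed.

Lemma nrm2Z c f : L 2%:E f -> nrm2 (cst c * f) = nsq c * nrm2 f.
Proof.
move=> /L2E[mf fi]; rewrite /nrm2 -RintZ//.
by apply: eq_Rintegral => x _; rewrite -nsqM.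
Qed.

Lemma nrm2B f g : L 2%:E f -> L 2%:E g ->
  nrm2 (f - g) = nrm2 f + nrm2 g - 2 * complex.Re (inner_prod f g).
Proof.
by move=> f2 g2; rewrite nrm2D ?ipNr ?nrm2N ?ReN ?mulrN//; exact: L2N.
Qed.

Section dominated.
Variables (g_ : nat -> T -> C) (g : T -> C) (G : T -> R).
Hypotheses (mg_ : forall n, cmeasurable (g_ n)) (iG : intg G).
Hypothesis gG : forall n x, nsq (g_ n x) <= G x.
Hypothesis cRe : forall x, complex.Re (g_ n x) @[n --> \oo] --> complex.Re (g x).
Hypothesis cIm : forall x, complex.Im (g_ n x) @[n --> \oo] --> complex.Im (g x).

Let mg : cmeasurable g.
Proof.
split.
- apply: (measurable_fun_cvg (h := fun n x => complex.Re (g_ n x))) => [n|x _].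
    by case: (mg_ n).
  exact: cRe.
- apply: (measurable_fun_cvg (h := fun n x => complex.Im (g_ n x))) => [n|x _].
    by case: (mg_ n).
  exact: cIm.
Qed.

Lemma nrm2_dct f : L 2%:E f ->
  L 2%:E (f - g) /\ nrm2 (f - g_ n) @[n --> \oo] --> nrm2 (f - g).
Proof.
move=> f2; have /L2E[mf fi] := f2.
have [] := @Rint_dct R (fun n => nsq \o (f - g_ n)) (nsq \o (f - g))
  (fun x => 2 * nsq (f x) + 2 * G x).
- by move=> n; apply: cmeas_nsq; apply: cmeasD => //; exact: cmeasN.
- exact: (intgD (intgZ 2 fi) (intgZ 2 iG)).
- move=> n x; rewrite ger0_norm ?nsq_ge0//=.
  apply: (le_trans (nsqD_le _ _)); rewrite nsqN lerD2l.
  exact: ler_wpM2l.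
- move=> x; rewrite /nsq /=.
  apply: cvgD; rewrite expr2; under eq_fun do rewrite expr2.
    apply: cvgM; rewrite -[(f - g) x]/(f x - g x) !ReImE.
      by under eq_fun do rewrite -[(f - _) x]/(f x - _) !ReImE;
         apply: cvgB; [exact: cvg_cst|exact: cRe].
    by under eq_fun do rewrite -[(f - _) x]/(f x - _) !ReImE;
       apply: cvgB; [exact: cvg_cst|exact: cRe].
  apply: cvgM; rewrite -[(f - g) x]/(f x - g x) !ReImE.
    by under eq_fun do rewrite -[(f - _) x]/(f x - _) !ReImE;
       apply: cvgB; [exact: cvg_cst|exact: cIm].
  by under eq_fun do rewrite -[(f - _) x]/(f x - _) !ReImE;
     apply: cvgB; [exact: cvg_cst|exact: cIm].
move=> i1 c1; split => //; apply/L2E; split => //.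
by apply: cmeasD => //; exact: cmeasN.
Qed.

Lemma L2_dct : L 2%:E g.
Proof.
have [h _] := nrm2_dct (Loo_L2 (Loo_cst 0)).
by have := L2N h; rewrite opprB subr0.
Qed.

Lemma ip_dct s : L 2%:E s -> (forall n, inner_prod (g_ n) s = 0) ->
  inner_prod g s = 0.
Proof.
move=> s2 g0; have /L2E[ms si] := L2J s2.
have iGs : intg (fun x => G x + nsq (conjf s x)) by exact: intgD.
have bnd n x : `|complex.Re ((g_ n * conjf s) x)| <= G x + nsq (conjf s x) /\
    `|complex.Im ((g_ n * conjf s) x)| <= G x + nsq (conjf s x).
  have := gG n x; rewrite -[(g_ n * conjf s) x]/(g_ n x * conjf s x) !(ReM, ImM) /nsq.
  move: (complex.Re (g_ n x)) (complex.Im (g_ n x)) (complex.Re (conjf s x)) (complex.Im (conjf s x)) (G x).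
  move=> a b c d e h; rewrite !ler_norml.
  have := sqr_ge0 (a - c); have := sqr_ge0 (a + c); have := sqr_ge0 (b - d).
  have := sqr_ge0 (b + d); have := sqr_ge0 (a - d); have := sqr_ge0 (a + d).
  have := sqr_ge0 (b - c); have := sqr_ge0 (b + c).
  by move=> *; split; apply/andP; split; nra.
have mp n : cmeasurable (g_ n * conjf s) by exact: cmeasM.
apply: eqC => /=.
- have [] := @Rint_dct R (fun n x => complex.Re ((g_ n * conjf s) x))
    (fun x => complex.Re ((g * conjf s) x)) (fun x => G x + nsq (conjf s x)).
  + by move=> n; case: (mp n).
  + exact: iGs.
  + by move=> n x; case: (bnd n x).
  + move=> x; rewrite -[(g * conjf s) x]/(g x * conjf s x) !ReImE.
    under eq_fun do rewrite -[(g_ _ * conjf s) x]/(g_ _ x * conjf s x) !ReImE.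
    by apply: cvgB; (apply: cvgM; last exact: cvg_cst); [exact: cRe|exact: cIm].
  + move=> _.
    have E n : Rint (fun x => complex.Re ((g_ n * conjf s) x)) = 0.
      exact: (congr1 (@complex.Re R) (g0 n)).
    under eq_fun do rewrite E.
    by move=> h; exact: (@cvg_unique _ (@Rhausdorff R) _ _ _ _ h (cvg_cst 0)).
- have [] := @Rint_dct R (fun n x => complex.Im ((g_ n * conjf s) x))
    (fun x => complex.Im ((g * conjf s) x)) (fun x => G x + nsq (conjf s x)).
  + by move=> n; case: (mp n).
  + exact: iGs.
  + by move=> n x; case: (bnd n x).
  + move=> x; rewrite -[(g * conjf s) x]/(g x * conjf s x) !ReImE.
    under eq_fun do rewrite -[(g_ _ * conjf s) x]/(g_ _ x * conjf s x) !ReImE.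
    by apply: cvgD; (apply: cvgM; last exact: cvg_cst); [exact: cRe|exact: cIm].
  + move=> _.
    have E n : Rint (fun x => complex.Im ((g_ n * conjf s) x)) = 0.
      exact: (congr1 (@complex.Im R) (g0 n)).
    under eq_fun do rewrite E.
    by move=> h; exact: (@cvg_unique _ (@Rhausdorff R) _ _ _ _ h (cvg_cst 0)).
Qed.

End dominated.

(** Subspaces are given as orthogonals of sets, a form in which their stability
    under dominated limits is the dominated convergence of inner products. *)
Definition orth (S : set (T -> C)) : set (T -> C) :=
  [set g | L 2%:E g /\ forall s, S s -> inner_prod g s = 0].

Section projection.
Variable S : set (T -> C).
Hypothesis SL2 : forall s, S s -> L 2%:E s.

Lemma orth_aeq f g : aeq f g -> cmeasurable g -> orth S f -> orth S g.
Proof.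
move=> fg mg [f2 fS]; split; first exact: L2_aeq fg mg f2.
move=> s Ss; rewrite -(fS s Ss); apply: ip_aeq => //; first exact: aeq_sym.
- exact: aeq_refl.
- exact: L2_cmeas.
- by apply: L2_cmeas; exact: SL2.
- by apply: L2_cmeas; exact: SL2.
Qed.

Lemma orthD f g : orth S f -> orth S g -> orth S (f + g).
Proof.
move=> [f2 fS] [g2 gS]; split; first exact: L2D.
by move=> s Ss; rewrite ipDl ?fS ?gS ?addr0//; exact: SL2.
Qed.

Lemma orthZ c f : orth S f -> orth S (cst c * f).
Proof.
move=> [f2 fS]; split; first exact: L2Z.
by move=> s Ss; rewrite ipZl ?fS ?mulr0//; exact: SL2.
Qed.

Lemma orth0 : orth S 0.
Proof.
have z2 : L 2%:E (0 : T -> C) by exact: (Loo_L2 (Loo_cst 0)).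
split => // s Ss; rewrite -(mul0r (inner_prod 0 s)) -(ipZl 0 z2 (SL2 Ss)).
by congr (inner_prod _ s); apply: funext => x; exact/esym/mul0r.
Qed.

Let dist f := inf [set nrm2 (f - g) | g in orth S].

Let dist_le f g : orth S g -> dist f <= nrm2 (f - g).
Proof.
move=> Sg; apply: inf_lbound; last by exists g.
by exists 0 => _ [h _ <-]; exact: nrm2_ge0.
Qed.

Let dist_lt f e : 0 < e -> exists2 g, orth S g & nrm2 (f - g) < dist f + e.
Proof.
move=> e0; have [|_ [g Sg <-] h] := @inf_adherent R [set nrm2 (f - g) | g in orth S] e e0.
  split; first by exists (nrm2 (f - 0)); exists 0 => //; exact: orth0.
  by exists 0 => _ [h _ <-]; exact: nrm2_ge0.
by exists g.
Qed.

(** The midpoint of g and h is again in the subspace, so that it is at least at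
    the infimal distance from f: almost minimizers are close to each other. *)
Let parallelogram f g h : L 2%:E f -> orth S g -> orth S h ->
  nrm2 (g - h) <= 2 * nrm2 (f - g) + 2 * nrm2 (f - h) - 4 * dist f.
Proof.
move=> f2 Sg Sh; have [g2 _] := Sg; have [h2 _] := Sh.
have fg := L2B f2 g2; have fh := L2B f2 h2.
have -> : g - h = (f - h) - (f - g).
  by apply: funext => x; rewrite -[LHS]/(g x - h x) -[RHS]/((f x - h x) - (f x - g x)); ring.
have hD := nrm2D fh fg; have hB := nrm2B fh fg.
have mid : orth S (cst 2^-1 * (g + h)) by apply/orthZ/orthD.
have e : (f - h) + (f - g) = cst 2 * (f - cst 2^-1 * (g + h)).
  apply: funext => x; rewrite -[LHS]/((f x - h x) + (f x - g x)).
  by rewrite -[RHS]/(2 * (f x - 2^-1 * (g x + h x))); field.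
move: hD; rewrite e nrm2Z; last by apply: L2B => //; case: mid.
have -> : nsq (2 : C) = 4 by rewrite /nsq /=; ring.
have := dist_le f mid; lra.
Qed.

(** Completeness of L^2 enters here. A minimizing sequence whose increments d_n
    have squared norm O(8^-n) makes H = sum 2^n |d_n|^2 integrable; where H is
    finite the increments are at most sqrt H 2^(-n/2), so the sequence converges
    pointwise and is dominated by a square integrable function. *)
Lemma orth_minimizer f : L 2%:E f ->
  exists2 g, orth S g & forall h, orth S h -> nrm2 (f - g) <= nrm2 (f - h).
Proof.
move=> f2; pose e n : R := (8^-1) ^+ n.
have e0 n : 0 < e n by rewrite exprn_gt0.
have /choice[g_ g_P] : forall n, exists g, orth S g /\ nrm2 (f - g) < dist f + e n.
  by move=> n; have [g] := dist_lt f (e0 n); exists g.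
have Sg n : orth S (g_ n) by case: (g_P n).
have g2 n : L 2%:E (g_ n) by case: (Sg n).
have mg n := L2_cmeas (g2 n).
pose del n := g_ n.+1 - g_ n.
have d2 n : L 2%:E (del n) by exact: L2B.
have del_le n : nrm2 (del n) <= 4 * e n.
  have := parallelogram f2 (Sg n.+1) (Sg n).
  have [_ h1] := g_P n; have [_ h2] := g_P n.+1.
  have : e n.+1 <= e n by rewrite /e exprS; have := e0 n; rewrite /e; lra.
  rewrite /del; lra.
pose H x := (\sum_(n <oo) (2 ^+ n * nsq (del n x))%:E)%E.
have H0 n x : (0 <= (2 ^+ n * nsq (del n x))%:E)%E.
  by rewrite lee_fin mulr_ge0 ?exprn_ge0 ?nsq_ge0.
have mterm n : measurable_fun [set: T] (fun x => (2 ^+ n * nsq (del n x))%:E).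
  apply/measurable_EFinP/measurable_funM => //; exact: (cmeas_nsq (L2_cmeas (d2 n))).
have iterm n : intg (fun x => 2 ^+ n * nsq (del n x)).
  by apply: intgZ; case/L2E : (d2 n).
have mH : measurable_fun [set: T] H.
  by apply: ge0_emeasurable_sum => // n x _ _; exact: H0.
have iH : m.-integrable [set: T] H.
  apply/integrableP; split => //.
  have -> : (\int[m]_x `|H x| = \int[m]_x H x)%E.
    by apply: eq_integral => x _; rewrite gee0_abs// nneseries_ge0.
  rewrite integral_nneseries//.
  apply: (@le_lt_trans _ _ (\sum_(n <oo) (geometric 4 (4^-1) n)%:E)%E).
    apply: lee_nneseries => [n _ _|n _]; first by apply: integral_ge0 => x _; exact: H0.
    have -> : (\int[m]_x (2 ^+ n * nsq (del n x))%:E =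
        (Rint (fun x => 2 ^+ n * nsq (del n x)))%:E)%E.
      by rewrite /Rintegral fineK//; apply: integrable_fin_num => //; exact: iterm.
    rewrite lee_fin RintZ; last by case/L2E : (d2 n).
    have -> : geometric 4 4^-1 n = 2 ^+ n * (4 * e n) :> R.
      by rewrite /e /= mulrCA -exprMn; congr (_ * _ ^+ _); field.
    by apply: ler_wpM2l; [exact: exprn_ge0|exact: del_le].
  have cg : cvgn (series (geometric 4 (4^-1 : R))).
    by apply: is_cvg_geometric_series; rewrite ger0_norm; lra.
  suff -> : (\sum_(n <oo) (geometric 4 (4^-1 : R) n)%:E = (limn (series (geometric 4 (4^-1 : R))))%:E)%E.
    by rewrite ltry.
  rewrite -EFin_lim//; congr (limn _); apply: funext => n.
  by rewrite /series/= sumEFin.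
pose A := [set x | (H x < +oo)%E].
have mA : measurable A.
  have -> : A = [set: T] `&` [set x | (H x < (cst +oo%E) x)%E] by rewrite setTI.
  by apply: emeasurable_fun_lt => //; exact: measurable_cst.
have aA : \forall x \ae m, x \in A.
  have := integrable_ae measurableT iH; apply: filterS => x /(_ I) h.
  by rewrite inE /A/= ltey_eq h.
pose hf x := if x \in A then fine (H x) else 0.
have hf0 x : 0 <= hf x.
  by rewrite /hf; case: ifP => // _; apply/fine_ge0/nneseries_ge0.
have mi : measurable_fun [set: T] (\1_A : T -> R) by [].
have hfE x : hf x = \1_A x * fine (H x).
  by rewrite /hf indicE; case: (x \in A); rewrite ?mul1r ?mul0r.
have ihf : intg hf.
  apply/integrableP; split.
    apply/measurable_EFinP; rewrite (_ : hf = fun x => \1_A x * fine (H x)); last exact: funext.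
    by apply: measurable_funM => //; exact: measurableT_comp.
  have /integrableP[_] := iH; apply: le_lt_trans; apply: ge0_le_integral => //.
  - apply: measurableT_comp => //; apply/measurable_EFinP.
    rewrite (_ : hf = fun x => \1_A x * fine (H x)); last exact: funext.
    by apply: measurable_funM => //; exact: measurableT_comp.
  - exact: measurableT_comp.
  - move=> x _ /=; rewrite ger0_norm// /hf gee0_abs ?nneseries_ge0//.
    case: ifP => [|_]; last exact: nneseries_ge0.
    rewrite inE /A/= => hx; rewrite fineK// ge0_fin_numE// nneseries_ge0//.
(* Zeroing the sequence outside of A makes it converge everywhere, so that the
   limit is measurable. *)
pose k_ n := toCf (\1_A) * g_ n.
have kE n x : k_ n x = if x \in A then g_ n x else 0.
  rewrite -[LHS]/((\1_A x)%:C%C * g_ n x) indicE; case: (x \in A); first exact: mul1r.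
  exact: mul0r.
have k2 n : L 2%:E (k_ n).
  apply: L2M => //; apply: Loo_toCf => // x.
  by rewrite indicE; case: (_ \in _); rewrite ?normr1 ?normr0.
have kae n : aeq (k_ n) (g_ n) by apply: filterS aA => x xA; rewrite kE xA.
pose q : R := Num.sqrt 2^-1.
have q0 : 0 <= q by exact: sqrtr_ge0.
have q2 : q ^+ 2 = 2^-1 by rewrite sqr_sqrtr.
have q1 : q < 1 by rewrite -sqrtr1 ltr_sqrt//; lra.
have bnd x n : nsq (k_ n.+1 x - k_ n x) <= hf x * 2^-1 ^+ n.
  rewrite !kE /hf; case: ifPn => [xA|_]; last by rewrite subrr nsq0 mul0r.
  rewrite exprVn ler_pdivlMr ?exprn_gt0// mulrC.
  have Hx : H x \is a fin_num.
    by rewrite ge0_fin_numE ?nneseries_ge0//; move: xA; rewrite inE.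
  rewrite -lee_fin fineK// /H (nneseriesD1 (n := n))//.
  by rewrite leeDl// nneseries_ge0.
have inc (P : C -> R) x : (forall a b, P (a - b) = P a - P b) ->
    (forall a, P a ^+ 2 <= nsq a) ->
    forall n, `|P (k_ n.+1 x) - P (k_ n x)| <= Num.sqrt (hf x) * q ^+ n.
  move=> PB Pn n; rewrite -PB -ler_sqr ?nnegrE ?mulr_ge0 ?sqrtr_ge0 ?exprn_ge0//.
  rewrite real_normK ?num_real// exprMn sqr_sqrtr// -exprM mulnC exprM q2.
  exact: le_trans (Pn _) (bnd x n).
have ReB (a b : C) : complex.Re (a - b) = complex.Re a - complex.Re b by rewrite !ReImE.
have ImB (a b : C) : complex.Im (a - b) = complex.Im a - complex.Im b by rewrite !ReImE.
have Rn (a : C) : complex.Re a ^+ 2 <= nsq a by rewrite lerDl sqr_ge0.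
have In (a : C) : complex.Im a ^+ 2 <= nsq a by rewrite lerDr sqr_ge0.
have q01 : 0 <= q < 1 by rewrite q0.
have cvR x := geometric_increments q01 (inc _ x ReB Rn).
have cvI x := geometric_increments q01 (inc _ x ImB In).
pose g x := (limn (fun n => complex.Re (k_ n x)) +i* limn (fun n => complex.Im (k_ n x)))%C.
pose K := (1 - q)^-1.
pose G x := 2 * nsq (k_ 0%N x) + 4 * K ^+ 2 * hf x.
have iG : intg G.
  by apply: intgD; apply: intgZ => //; case/L2E : (k2 0%N).
have kG n x : nsq (k_ n x) <= G x.
  have [_ /(_ n) hR] := cvR x; have [_ /(_ n) hI] := cvI x.
  have sq (a b : R) : `|a - b| <= Num.sqrt (hf x) * K -> a ^+ 2 <= 2 * b ^+ 2 + 2 * (K ^+ 2 * hf x).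
    move=> h; have : (a - b) ^+ 2 <= K ^+ 2 * hf x.
      rewrite -[hf x]sqr_sqrtr// -exprMn mulrC -(real_normK (num_real _)).
      by rewrite ler_sqr ?nnegrE// mulr_ge0 ?sqrtr_ge0// invr_ge0 subr_ge0 ltW.
    have := sqr_ge0 (a - 2 * b); nra.
  have := sq _ _ hR; have := sq _ _ hI; rewrite /G /nsq; lra.
have mk n := L2_cmeas (k2 n).
have cRe x : complex.Re (k_ n x) @[n --> \oo] --> complex.Re (g x).
  by case: (cvR x).
have cIm x : complex.Im (k_ n x) @[n --> \oo] --> complex.Im (g x).
  by case: (cvI x).
have g2' := L2_dct mk iG kG cRe cIm.
have Sk n : orth S (k_ n) by apply: orth_aeq (Sg n) => //; exact: aeq_sym.
have Sgg : orth S g.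
  split => // s Ss; apply: (ip_dct mk iG kG cRe cIm) => //; first exact: SL2.
  by move=> n; case: (Sk n) => _; exact.
exists g => // h Sh; apply: le_trans (dist_le f Sh).
have [_ cvn] := nrm2_dct mk iG kG cRe cIm f2.
have kd n : nrm2 (f - k_ n) <= dist f + e n.
  rewrite (@nrm2_aeq _ _ (f - g_ n)); first by apply: ltW; case: (g_P n).
  - by apply: cmeasD; [exact: L2_cmeas|exact: cmeasN].
  - by apply: cmeasD; [exact: L2_cmeas|exact: cmeasN].
  - by apply: filterS (kae n) => x E; rewrite -[LHS]/(f x - k_ n x) E.
have ce : dist f + e n @[n --> \oo] --> dist f.
  rewrite -[X in _ --> X]addr0; apply: cvgD; first exact: cvg_cst.
  by apply: cvg_expr; rewrite ger0_norm; lra.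
by apply: (ler_cvg_to cvn ce); apply: nearW => n; exact: kd.
Qed.

(** Moving the minimizer g along h by a small multiple of the inner product of
    f - g with h would decrease the distance if that product were not zero. *)
Theorem orth_projection f : L 2%:E f ->
  exists2 g, orth S g & forall h, orth S h -> inner_prod (f - g) h = 0.
Proof.
move=> f2; have [g Sg gmin] := orth_minimizer f2; exists g => // h Sh.
have [g2 _] := Sg; have [h2 _] := Sh; have fg := L2B f2 g2.
set a := inner_prod (f - g) h.
apply: nsq_eq0; apply/eqP; rewrite eq_le nsq_ge0 andbT.
(* The step t of the perturbation is chosen so that t |h|^2 < 1. *)
pose N := nrm2 h; pose t : R := (N + 1)^-1.
have N0 : 0 <= N by exact: nrm2_ge0.
have tN : t * (N + 1) = 1 by rewrite mulVf// gt_eqF//; lra.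
have t0 : 0 < t by rewrite invr_gt0; lra.
have Sc : orth S (g + cst (t%:C%C * a) * h) by apply: orthD => //; exact: orthZ.
have := gmin _ Sc; rewrite opprD addrA (nrm2B fg (L2Z _ h2)).
rewrite nrm2Z// ipZr// -/a nsqM -/N.
have -> : complex.Re ((t%:C%C * a)^*%C * a) = t * nsq a.
  by rewrite /nsq !ReImE /=; ring.
have -> : nsq (t%:C%C : C) = t ^+ 2 by rewrite /nsq /=; ring.
have := nsq_ge0 a; move: (nsq a) => b b0 h3.
have : 0 <= t * b * (t * N - 2) by lra.
have -> : t * N = 1 - t by lra.
move=> h4; have : t * b * (1 + t) <= 0 by lra.
rewrite pmulr_lle0; last by lra.
by rewrite pmulr_rle0.
Qed.

End projection.

End orthogonal_projection.

(** * The Hardy space and its complement *)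

Section hardy_space.
Context {R : realType}.
Local Notation C := R[i].
Local Notation T := (circle R).
Local Notation m := (circle_measure R).
Implicit Types f g h : T -> C.

Lemma faddE f g x : (f + g) x = f x + g x. Proof. by []. Qed.
Lemma fmulE f g x : (f * g) x = f x * g x. Proof. by []. Qed.
Lemma foppE f x : (- f) x = - f x. Proof. by []. Qed.
Lemma f1E x : (1 : T -> C) x = 1. Proof. by []. Qed.
Lemma f0E x : (0 : T -> C) x = 0. Proof. by []. Qed.
Lemma fcstE c x : (cst c : T -> C) x = c. Proof. by []. Qed.
Lemma conjfE f x : conjf f x = (f x)^*%C. Proof. by []. Qed.
Definition fE := (faddE, fmulE, foppE, f1E, f0E, fcstE, conjfE).

(** The orthogonal complement of H^2, described by Fourier coefficients; it is
    the space of the conjugates of the functions of z H^2. *)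
Definition Hm : set (T -> C) :=
  [set f | L 2%:E f /\ forall n : int, 0 <= n -> fourier f n = 0].

Lemma H2_L2 f : H2 f -> L 2%:E f. Proof. by case. Qed.
Lemma Hm_L2 f : Hm f -> L 2%:E f. Proof. by case. Qed.

Lemma H2_aeq f g : aeq f g -> cmeasurable g -> H2 f -> H2 g.
Proof.
move=> fg mg [f2 f0]; split; first exact: L2_aeq fg mg f2.
by move=> n n0; rewrite -(fourier_aeq n _ mg fg) ?f0//; exact: L2_cmeas.
Qed.

Lemma Hm_aeq f g : aeq f g -> cmeasurable g -> Hm f -> Hm g.
Proof.
move=> fg mg [f2 f0]; split; first exact: L2_aeq fg mg f2.
by move=> n n0; rewrite -(fourier_aeq n _ mg fg) ?f0//; exact: L2_cmeas.
Qed.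

Lemma H2D f g : H2 f -> H2 g -> H2 (f + g).
Proof.
move=> [f2 f0] [g2 g0]; split; first exact: L2D.
by move=> n n0; rewrite fourierD// f0// g0// addr0.
Qed.

Lemma H2N f : H2 f -> H2 (- f).
Proof.
move=> [f2 f0]; split; first exact: L2N.
by move=> n n0; rewrite fourierN// f0// oppr0.
Qed.

Lemma H2B f g : H2 f -> H2 g -> H2 (f - g).
Proof. by move=> f2 g2; apply: H2D => //; exact: H2N. Qed.

Lemma H2Z c f : H2 f -> H2 (cst c * f).
Proof.
move=> [f2 f0]; split; first exact: L2Z.
by move=> n n0; rewrite fourierZ// f0// mulr0.
Qed.

Lemma HmD f g : Hm f -> Hm g -> Hm (f + g).
Proof.
move=> [f2 f0] [g2 g0]; split; first exact: L2D.
by move=> n n0; rewrite fourierD// f0// g0// addr0.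
Qed.

Lemma HmN f : Hm f -> Hm (- f).
Proof.
move=> [f2 f0]; split; first exact: L2N.
by move=> n n0; rewrite fourierN// f0// oppr0.
Qed.

Lemma HmB f g : Hm f -> Hm g -> Hm (f - g).
Proof. by move=> f2 g2; apply: HmD => //; exact: HmN. Qed.

Lemma HmZ c f : Hm f -> Hm (cst c * f).
Proof.
move=> [f2 f0]; split; first exact: L2Z.
by move=> n n0; rewrite fourierZ// f0// mulr0.
Qed.

Lemma H2_zn n : 0 <= n -> H2 (zn n : T -> C).
Proof.
move=> n0; split; first exact: L2_zn.
move=> k k0; rewrite fourier_zn; case: eqP => // kn; move: k0.
by rewrite kn ltNge n0.
Qed.

Lemma Hm_zn n : n < 0 -> Hm (zn n : T -> C).
Proof.
move=> n0; split; first exact: L2_zn.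
move=> k k0; rewrite fourier_zn; case: eqP => // kn; move: n0.
by rewrite -kn ltNge k0.
Qed.

Lemma H2_cst c : H2 (cst c : T -> C).
Proof.
have -> : (cst c : T -> C) = cst c * zn 0 by rewrite zn0 mulr1.
by apply/H2Z/H2_zn.
Qed.

Lemma Hinf_cst c : Hinf (cst c : T -> C).
Proof. by split; [exact: Loo_cst|exact: H2_cst]. Qed.

Lemma Hinf_zf : Hinf (zf : T -> C).
Proof. by split; [exact: Loo_z|rewrite -zn1; exact: H2_zn]. Qed.

Lemma H2_Hm_0 f : H2 f -> Hm f -> aeq f 0.
Proof.
move=> [f2 f0] [_ f1]; apply: fourier_inj => // n.
by have [/f1|/f0] := leP 0 n.
Qed.

(** Both spaces being defined by coefficients, orthogonality needs the density of
    the characters: the component of f orthogonal to the orthogonal of Hm has no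
    nonzero coefficient, and hence vanishes. *)
Lemma H2_Hm_orth f g : H2 f -> Hm g -> inner_prod f g = 0.
Proof.
move=> [f2 f0] [g2 g0].
have HL s : Hm s -> L 2%:E s by case.
have [p [p2 pH] pP] := orth_projection HL f2.
have fp2 := L2B f2 p2.
have fp0 : aeq (f - p) 0.
  apply: fourier_inj => // n; have [n0|n0] := leP 0 n.
    rewrite fourierE; apply: pP; split; first exact: L2_zn.
    move=> s [s2 s0]; rewrite (ipC s2 (L2_zn _)) -fourierE s0//.
    exact: conjc0.
  rewrite fourierB// f0// (fourierE p) pH ?subr0//; exact: Hm_zn.
rewrite -(pH g)//; apply: ip_aeq; try exact: L2_cmeas; last exact: aeq_refl.
by apply: filterS fp0 => x; rewrite !fE => /eqP; rewrite subr_eq0 => /eqP.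
Qed.

Lemma Pplus_spec f : L 2%:E f -> H2 (Pplus f) /\ Hm (Pminus f).
Proof.
move=> f2.
pose S := [set s : T -> C | exists2 n : int, n < 0 & s = zn n].
have SL s : S s -> L 2%:E s by move=> [n _ ->]; exact: L2_zn.
have SH g : orth S g <-> H2 g.
  split=> -[g2 g0]; split=> //.
    by move=> n n0; rewrite fourierE; apply: g0; exists n.
  by move=> _ [n n0 ->]; rewrite -fourierE; exact: g0.
have [g Sg gP] := orth_projection SL f2.
have : [set g | H2 g /\ forall h, H2 h -> inner_prod (f - g) h = 0] g.
  by split; [exact/SH|move=> h /SH; exact: gP].
move=> /(xgetI (0 : T -> C)); rewrite -[xget _ _]/(Pplus f) => -[h1 h2].
split => //; split; first by apply: L2B => //; exact: H2_L2.
by move=> n n0; rewrite fourierE; apply: h2; exact: H2_zn.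
Qed.

Lemma H2_Pplus f : L 2%:E f -> H2 (Pplus f).
Proof. by move=> /Pplus_spec[]. Qed.

Lemma Hm_Pminus f : L 2%:E f -> Hm (Pminus f).
Proof. by move=> /Pplus_spec[]. Qed.

Lemma PplusE f p q : L 2%:E f -> H2 p -> Hm q -> aeq f (p + q) -> aeq (Pplus f) p.
Proof.
move=> f2 Hp Hq fpq; have [H1 H3] := Pplus_spec f2.
have d0 : aeq (Pplus f - p) 0.
  apply: H2_Hm_0; first exact: H2B.
  apply: (@Hm_aeq (q - Pminus f)); last exact: HmB.
    by apply: filterS fpq => x; rewrite /Pminus !fE => ->; ring.
  by apply: cmeasD; [exact/L2_cmeas/H2_L2|apply/cmeasN/L2_cmeas/H2_L2].
by apply: filterS d0 => x; rewrite !fE => /eqP; rewrite subr_eq0 => /eqP.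
Qed.

Lemma Pplus_H2 f : H2 f -> aeq (Pplus f) f.
Proof.
move=> Hf; have [f2 _] := Hf.
have Hz : Hm (cst 0 * f) by split; [exact: L2Z|move=> n _; rewrite fourierZ// mul0r].
apply: (PplusE f2 Hf Hz); apply: aeW => x; rewrite !fE; ring.
Qed.

Lemma Pplus_Hm f : Hm f -> aeq (Pplus f) 0.
Proof.
move=> Hf; have [f2 _] := Hf.
have Hz : H2 (cst 0 * f) by split; [exact: L2Z|move=> n _; rewrite fourierZ// mul0r].
apply: (aeq_trans (PplusE f2 Hz Hf _)); apply: aeW => x; rewrite !fE; ring.
Qed.

Lemma Pplus_aeq f g : L 2%:E f -> L 2%:E g -> aeq f g -> aeq (Pplus f) (Pplus g).
Proof.
move=> f2 g2 fg; have [H1 H3] := Pplus_spec g2.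
apply: (PplusE f2 H1 H3); apply: filterS fg => x; rewrite /Pminus !fE => ->; ring.
Qed.

Lemma PplusD f g : L 2%:E f -> L 2%:E g ->
  aeq (Pplus (f + g)) (Pplus f + Pplus g).
Proof.
move=> f2 g2; have [H1 H3] := Pplus_spec f2; have [H1' H3'] := Pplus_spec g2.
apply: (PplusE (L2D f2 g2) (H2D H1 H1') (HmD H3 H3')).
by apply: aeW => x; rewrite /Pminus !fE; ring.
Qed.

(** The conjugation f |-> conj (z f), which exchanges H^2 and its complement. *)
Definition Jf f : T -> C := conjf zf * conjf f.

Lemma Jf_H2 f : H2 f -> Hm (Jf f).
Proof.
move=> [f2 f0]; split.
  by apply: L2M; [exact/LooJ/Loo_z|exact: L2J].
move=> n n0; rewrite /Jf -znN1 fourier_shift fourier_conj// f0 ?conjc0//.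
by move: n0; lia.
Qed.

Lemma Jf_Hm f : Hm f -> H2 (Jf f).
Proof.
move=> [f2 f0]; split.
  by apply: L2M; [exact/LooJ/Loo_z|exact: L2J].
move=> n n0; rewrite /Jf -znN1 fourier_shift fourier_conj// f0 ?conjc0//.
by move: n0; lia.
Qed.

Lemma JfK f : Jf (Jf f) = f.
Proof.
apply: funext => x; have := zJz x; rewrite /Jf !fE !cJM !conjcK.
rewrite -[zf x]/(x : C) => e.
by rewrite mulrA (mulrC _^*%C) e mul1r.
Qed.

(** The n-th coefficient of a f is the inner product of f with conj a z^n, which
    is orthogonal to H^2 for n < 0. *)
Lemma H2M a f : Hinf a -> H2 f -> H2 (a * f).
Proof.
move=> [ao [a2 a0]] Hf; have [f2 _] := Hf; split; first exact: L2M.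
move=> n n0; rewrite fourierE ipM fmulC; apply: H2_Hm_orth => //.
split; first by apply: L2M; [exact: Loo_zn|exact: L2J].
move=> k k0; rewrite fourier_shift fourier_conj// a0 ?conjc0//.
by move: n0 k0; lia.
Qed.

Lemma HmM a f : Hinf a -> Hm f -> Hm (conjf a * f).
Proof.
move=> Ha Hf; have [f2 _] := Hf; have [ao _] := Ha.
split; first by apply: L2M => //; exact: LooJ.
move=> n n0; rewrite fourierE ipM conjfK.
have Hz : H2 (a * zn n) by apply: H2M => //; exact: H2_zn.
by rewrite (ipC (H2_L2 Hz) f2) H2_Hm_orth// conjc0.
Qed.

Lemma HinfM (a b : T -> C) : Hinf a -> Hinf b -> Hinf (a * b).
Proof. by move=> Ha [bo Hb]; split; [apply: LooM => //; case: Ha|exact: H2M]. Qed.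

Lemma HinfB (a b : T -> C) : Hinf a -> Hinf b -> Hinf (a - b).
Proof. by move=> [ao Ha] [bo Hb]; split; [exact: LooB|exact: H2B]. Qed.

Lemma Hinf_aeq f g : aeq f g -> cmeasurable g -> Hinf f -> Hinf g.
Proof. by move=> fg mg [fo Hf]; split; [exact: Loo_aeq fg mg fo|exact: H2_aeq fg mg Hf]. Qed.

(** Evaluation at the origin is multiplicative: a minus its mean is conjugate to
    a function orthogonal to H^2. *)
Lemma fourier0_M a f : Hinf a -> H2 f ->
  fourier (a * f) 0 = fourier a 0 * fourier f 0.
Proof.
move=> [ao [a2 a0]] Hf; have [f2 _] := Hf.
set c := fourier a 0.
have -> : a * f = cst c * f + (a - cst c) * f by apply: funext => x; rewrite !fE; ring.
have ac : L +oo%E (a - cst c) by apply: LooB => //; exact: Loo_cst.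
have ac2 := L2M ac f2.
rewrite fourierD//; last exact: L2Z.
rewrite fourierZ// (fourierE ((a - cst c) * f)) zn0 ipM mulr1 H2_Hm_orth ?addr0//.
split; first by apply/L2J/Loo_L2.
move=> n; rewrite fourier_conj; last exact: Loo_L2.
rewrite le_eqVlt => /orP[/eqP <-|n0].
  rewrite oppr0 fourierB//; last exact: (H2_L2 (H2_cst _)).
  rewrite -/c (_ : fourier (cst c) 0 = c) ?subrr ?conjc0//.
  by rewrite -[cst c]mulr1 -zn0 fourierZ ?fourier_zn ?eqxx ?mulr1//; exact: L2_zn.
rewrite fourierB// ?a0 ?oppr_lt0//; last exact: (H2_L2 (H2_cst _)).
by have [_ ->] := H2_cst c; rewrite ?subrr ?conjc0// oppr_lt0.
Qed.

End hardy_space.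

(** * Inner functions and model projections *)

Section inner_functions.
Context {R : realType}.
Local Notation C := R[i].
Local Notation T := (circle R).
Local Notation m := (circle_measure R).
Implicit Types f g h u v : T -> C.

Lemma fourier_cst (c : C) n : fourier (cst c : T -> C) n = c * (n == 0)%:R.
Proof.
by rewrite -[cst c]mulr1 -zn0 fourierZ ?fourier_zn//; exact: L2_zn.
Qed.

(** What remains of |g|^2 = k |b|^2 and |g|^2 = |a|^2 + |b|^2 when k <= 1. *)
Lemma energy_balance (A B k : R) : 0 <= A -> 0 <= B -> k <= 1 ->
  k * B = A + B -> A = 0 /\ (k < 1 -> B = 0).
Proof.
move=> A0 B0 k1 e; split=> [|k1'].
  by apply/eqP; rewrite eq_le A0 andbT; have := ler_piMl B0 k1; lra.
apply/eqP; rewrite eq_le B0 andbT -(@pmulr_rle0 _ (1 - k)) ?subr_gt0//.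
by rewrite mulrBl mul1r; lra.
Qed.

Section one_inner.
Variable al : T -> C.
Hypothesis hal : inner_fun al.

Lemma inner_Hinf : Hinf al. Proof. by case: hal. Qed.
Lemma inner_Loo : L +oo%E al. Proof. by case: inner_Hinf. Qed.
Lemma inner_cmeas : cmeasurable al. Proof. exact: Loo_cmeas inner_Loo. Qed.
Lemma inner_LooJ : L +oo%E (conjf al). Proof. exact/LooJ/inner_Loo. Qed.

Lemma inner_mulJ : \forall x \ae m, al x * (al x)^*%C = 1.
Proof. by have [_] := hal; apply: filterS => x; exact: norm1_mulJ. Qed.

Lemma inner_nsq : \forall x \ae m, nsq (al x) = 1.
Proof. by have [_] := hal; apply: filterS => x; exact: norm1_nsq. Qed.

Lemma nrm2_inner f : L 2%:E f -> nrm2 (al * f) = nrm2 f.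
Proof.
move=> f2; apply: Rint_aeq.
- by apply: cmeas_nsq; apply: cmeasM; [exact: inner_cmeas|exact: L2_cmeas].
- by apply: cmeas_nsq; exact: L2_cmeas.
- by apply: filterS inner_nsq => x h /=; rewrite fmulE nsqM h mul1r.
Qed.

(** The squared distance of al to its mean is 1 - |mean|^2, and it is positive as
    al is not constant. *)
Lemma inner_mean_lt1 : nonconstant al -> nsq (fourier al 0) < 1.
Proof.
move=> nal; set c := fourier al 0.
have al2 := Loo_L2 inner_Loo; have c2 := H2_L2 (H2_cst c).
have n1 : nrm2 al = 1.
  rewrite -[al]mulr1 nrm2_inner; last exact: Loo_L2 Loo1.
  by rewrite /nrm2 (_ : _ \o _ = fun=> 1) ?Rint_cst//; apply: funext => x /=; rewrite nsq1.
have nc : nrm2 (cst c : T -> C) = nsq c by exact: (Rint_cst (nsq c)).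
have ipc : inner_prod al (cst c) = c^*%C * c.
  rewrite -[cst c]mulr1 ipZr//; last exact: Loo_L2 Loo1.
  by rewrite -zn0 -fourierE.
have e : nrm2 (al - cst c) = 1 - nsq c.
  rewrite nrm2B// n1 nc ipc -[c^*%C * c]mulrC -nsqE /=; ring.
have : 0 <= 1 - nsq c by rewrite -e nrm2_ge0.
rewrite subr_ge0 le_eqVlt => /orP[/eqP c1|//]; exfalso; apply: nal; exists c.
apply/aeqE; have := nrm2_eq0 (L2B al2 c2); rewrite e c1 subrr => /(_ erefl).
by apply: filterS => x; rewrite !fE => /eqP; rewrite subr_eq0 => /eqP.
Qed.

Lemma H2_zJ (G : T -> C) : H2 G -> fourier G 0 = 0 -> H2 (conjf zf * G).
Proof.
move=> [G2 G0] g0; split; first by apply: L2M => //; exact/LooJ/Loo_z.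
move=> n n0; rewrite -znN1 fourier_shift.
have [->|nN] := eqVneq n (-1); first by rewrite subrr.
by apply: G0; move: n0 nN; lia.
Qed.

(** The mean of (al - mu) G is (mean al - mu) times the mean of G, so G(0) = 0;
    then conj z G is analytic and satisfies the same hypotheses, and all the
    coefficients of G vanish in turn. This replaces the fact that a nonzero
    analytic function vanishes on a null set only. *)
Lemma inner_level_null (mu : C) G : fourier al 0 != mu -> H2 G ->
  aeq ((al - cst mu) * G) 0 -> aeq G 0.
Proof.
move=> muN HG aG.
have key (n : nat) : forall G, H2 G -> aeq ((al - cst mu) * G) 0 ->
    fourier G n = 0.
  have z0 G' : H2 G' -> aeq ((al - cst mu) * G') 0 -> fourier G' 0 = 0.
    move=> HG' aG'; have Hm : Hinf (al - cst mu).
      by apply: HinfB; [exact: inner_Hinf|exact: Hinf_cst].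
    have mG := L2_cmeas (H2_L2 (H2M Hm HG')).
    have := fourier0_M Hm HG'.
    rewrite (fourier_aeq 0 mG cmeas0 aG') fourierB; first last.
    - exact: H2_L2 (H2_cst _).
    - exact: Loo_L2 inner_Loo.
    rewrite fourier_cst eqxx mulr1 => /esym/eqP.
    have -> : fourier (0 : T -> C) 0 = 0.
      by rewrite (_ : 0 = cst 0)// fourier_cst mul0r.
    by rewrite mulf_eq0 subr_eq0 (negbTE muN) /= => /eqP.
  elim: n => [|n ih] G' HG' aG'; first exact: z0.
  have H' := H2_zJ HG' (z0 _ HG' aG').
  have := ih _ H'; rewrite -znN1 fourier_shift.
  have -> : n%:Z - -1 = n.+1%:Z by lia.
  by apply; apply: filterS aG' => x; rewrite !fE mulrCA => ->; rewrite mulr0.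
apply: fourier_inj; first exact: H2_L2.
by case=> n; [exact: key|case: HG => _; apply].
Qed.

(** For |mu| <= 1 a factor 1 - mu al can be divided out of an H^2 function. Let g
    be the part of f orthogonal to H^2. Then g = mu P_-(al g), and as
    multiplication by al is isometric this forces g = mu al g. If |mu| < 1 then
    g = 0; otherwise the analytic function conj (z g) is killed by al - conj mu,
    and inner_level_null applies because the mean of al has modulus < 1. *)
Lemma inner_div (mu : C) f : nonconstant al -> nsq mu <= 1 -> L 2%:E f ->
  H2 ((1 - cst mu * al) * f) -> H2 f.
Proof.
move=> nal mu1 f2 Hf.
have [Hp Hg] := Pplus_spec f2; set p := Pplus f in Hp; set g := Pminus f in Hg.
have fpg : f = p + g by apply: funext => x; rewrite /g /Pminus !fE -/p; ring.
have g2 := Hm_L2 Hg.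
have mual : Hinf (1 - cst mu * al).
  apply: HinfB; first exact: (Hinf_cst 1).
  by apply: HinfM; [exact: Hinf_cst|exact: inner_Hinf].
have Hmg : H2 ((1 - cst mu * al) * g).
  have -> : (1 - cst mu * al) * g = (1 - cst mu * al) * f - (1 - cst mu * al) * p.
    by rewrite fpg; apply: funext => x; rewrite !fE; ring.
  by apply: H2B => //; exact: H2M.
have ag2 : L 2%:E (al * g) by apply: L2M => //; exact: inner_Loo.
have [Ha Hb] := Pplus_spec ag2.
set a := Pplus (al * g) in Ha; set b := Pminus (al * g) in Hb.
have a2 := H2_L2 Ha; have b2 := Hm_L2 Hb.
have agab : al * g = a + b by apply: funext => x; rewrite /b /Pminus !fE -/a; ring.
have gb : aeq g (cst mu * b).
  have : aeq (g - cst mu * b) 0.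
    apply: H2_Hm_0; last by apply: HmB => //; exact: HmZ.
    have -> : g - cst mu * b = (1 - cst mu * al) * g + cst mu * a.
      apply: funext => x; have := congr1 (fun f => f x) agab; rewrite !fE => e.
      by rewrite mulrBl -mulrA e; ring.
    by apply: H2D => //; exact: H2Z.
  by apply: filterS => x; rewrite !fE => /eqP; rewrite subr_eq0 => /eqP.
have n1 : nrm2 g = nsq mu * nrm2 b.
  by rewrite -nrm2Z//; apply: nrm2_aeq gb; [exact: L2_cmeas|apply: L2_cmeas; exact: L2Z].
have n2 : nrm2 g = nrm2 a + nrm2 b.
  rewrite -(nrm2_inner g2) agab nrm2D// H2_Hm_orth//= ?mulr0 ?addr0//.
have na := nrm2_ge0 a; have nb := nrm2_ge0 b; have nm := nsq_ge0 mu.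
have [na0 nb0] := energy_balance na nb mu1 (etrans (esym n1) n2).
have a0 : aeq a 0 by exact: nrm2_eq0.
have gal : aeq g (cst mu * (al * g)).
  by apply: filterS2 gb a0 => x; rewrite !fE => e1 e2;
     rewrite [LHS]e1; have := congr1 (fun f => f x) agab; rewrite !fE => ->; rewrite e2 add0r.
have g0 : aeq g 0.
  move: mu1; rewrite le_eqVlt => /orP[/eqP mu1|mu1]; last first.
    by apply: nrm2_eq0 => //; rewrite n1 nb0 ?mulr0.
  have muN : fourier al 0 != mu^*%C.
    by apply/eqP => e; have := inner_mean_lt1 nal; rewrite e nsqJ mu1 ltxx.
  have HG := Jf_Hm Hg.
  have aG : aeq ((al - cst mu^*%C) * Jf g) 0.
    apply: filterS2 gal inner_mulJ => x; rewrite /Jf !fE => e1 e2.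
    have -> : (al x - mu^*%C) * ((zf x)^*%C * (g x)^*%C) =
      (zf x)^*%C * (al x * (g x)^*%C - mu^*%C * (g x)^*%C) by ring.
    by rewrite {1}e1 !cJM mulrCA (mulrA (al x)) e2 mul1r subrr mulr0.
  have G0 := inner_level_null muN HG aG.
  rewrite -(JfK g); apply: filterS G0 => x e.
  by rewrite /Jf fmulE [conjf (conjf _ * _) x]conjfE -/(Jf g) e conjc0 mulr0.
apply: (H2_aeq _ _ Hp); last exact: L2_cmeas.
by apply: filterS g0 => x e; rewrite fpg fE e addr0.
Qed.

(** The projection of L^2 onto the model space of al. *)
Definition Pa u : T -> C := Pplus u - al * Pplus (conjf al * u).

Let L2a u : L 2%:E u -> L 2%:E (conjf al * u).
Proof. by apply: L2M; exact: inner_LooJ. Qed.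

Lemma Pa_H2 u : L 2%:E u -> H2 (Pa u).
Proof.
move=> u2; apply: H2B; first exact: H2_Pplus.
by apply: H2M; [exact: inner_Hinf|exact/H2_Pplus/L2a].
Qed.

Lemma Pa_L2 u : L 2%:E u -> L 2%:E (Pa u).
Proof. by move=> u2; exact/H2_L2/Pa_H2. Qed.

Lemma PaE u : aeq (Pa u) (al * Pminus (conjf al * u) - Pminus u).
Proof.
apply: filterS inner_mulJ => x; rewrite /Pa /Pminus !fE => e.
by rewrite mulrBr mulrA e; ring.
Qed.

Lemma Pa_Hm u : L 2%:E u -> Hm (conjf al * Pa u).
Proof.
move=> u2.
have H : Hm (Pminus (conjf al * u) - conjf al * Pminus u).
  apply: HmB; first exact/Hm_Pminus/L2a.
  by apply: HmM; [exact: inner_Hinf|exact: Hm_Pminus].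
apply: (Hm_aeq _ _ H); last exact/L2_cmeas/L2a/Pa_L2.
apply: filterS2 inner_mulJ (PaE u) => x e; rewrite !fE => ->.
transitivity (al x * (al x)^*%C * Pminus (conjf al * u) x - (al x)^*%C * Pminus u x).
  by rewrite e mul1r.
by ring.
Qed.

Lemma Pa_aeq u v : L 2%:E u -> L 2%:E v -> aeq u v -> aeq (Pa u) (Pa v).
Proof.
move=> u2 v2 uv.
have uv' : aeq (conjf al * u) (conjf al * v) by apply: filterS uv => x; rewrite !fE => ->.
apply: filterS2 (Pplus_aeq u2 v2 uv) (Pplus_aeq (L2a u2) (L2a v2) uv') => x.
by rewrite /Pa !fE => -> ->.
Qed.

Lemma PaD u v : L 2%:E u -> L 2%:E v -> aeq (Pa (u + v)) (Pa u + Pa v).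
Proof.
move=> u2 v2; rewrite /Pa mulrDr.
apply: filterS2 (PplusD u2 v2) (PplusD (L2a u2) (L2a v2)) => x.
by rewrite !fE => -> ->; ring.
Qed.

Lemma Pa_Hm0 u : Hm u -> aeq (Pa u) 0.
Proof.
move=> Hu; have Hu' := HmM inner_Hinf Hu.
apply: filterS2 (Pplus_Hm Hu) (Pplus_Hm Hu') => x.
by rewrite /Pa !fE => -> ->; rewrite mulr0 subr0.
Qed.

Lemma Pa_alH2 u : L 2%:E u -> H2 (conjf al * u) -> aeq (Pa u) 0.
Proof.
move=> u2 Hu.
have Hau := H2M inner_Hinf Hu.
have ua : aeq u (al * (conjf al * u)).
  by apply: filterS inner_mulJ => x; rewrite !fE mulrA => ->; rewrite mul1r.
have Pu : aeq (Pplus u) u.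
  by apply: Pplus_H2; apply: (H2_aeq (aeq_sym ua)) => //; exact: L2_cmeas.
apply: (filterS3 _ _ Pu (Pplus_H2 Hu) ua) => x.
by rewrite /Pa !fE => -> -> <-; rewrite subrr.
Qed.

Lemma Pplus_z v : L 2%:E v ->
  aeq (Pplus (zf * v)) (zf * Pplus v + cst (fourier (zf * v) 0)).
Proof.
move=> v2; have [Hp Hq] := Pplus_spec v2; set c := fourier _ _.
have zv2 : L 2%:E (zf * v) by apply: L2M => //; exact: Loo_z.
have zq2 : L 2%:E (zf * Pminus v) by apply: L2M; [exact: Loo_z|exact: Hm_L2].
have zp2 : L 2%:E (zf * Pplus v) by apply: L2M; [exact: Loo_z|exact: H2_L2].
apply: (@PplusE _ _ _ (zf * Pminus v - cst c)) => //.
- by apply: H2D; [apply: H2M => //; exact: Hinf_zf|exact: H2_cst].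
- split; first by apply: L2B => //; exact/H2_L2/H2_cst.
  move=> n n0; rewrite fourierB//; last exact/H2_L2/H2_cst.
  rewrite fourier_cst; have [->|n0'] := eqVneq n 0.
    rewrite mulr1; have -> : zf * Pminus v = zf * v - zf * Pplus v.
      by rewrite /Pminus mulrBr.
    rewrite fourierB// -/c -zn1 fourier_shift.
    by have [_ ->] := Hp; rewrite ?subr0 ?subrr// oppr_lt0.
  rewrite mulr0 subr0 -zn1 fourier_shift; case: Hq => _; apply.
  by move: n0 n0'; lia.
- by apply: aeW => x; rewrite /Pminus !fE; ring.
Qed.

(** The commutator of the model projection with the shift takes its values in
    the span of 1 and al. *)
Lemma Pa_z u : L 2%:E u ->
  aeq (zf * Pa u - Pa (zf * u))
    (cst (fourier (conjf al * (zf * u)) 0) * al - cst (fourier (zf * u) 0)).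
Proof.
move=> u2; have e : conjf al * (zf * u) = zf * (conjf al * u).
  by apply: funext => x; rewrite !fE; ring.
rewrite e /Pa e.
apply: filterS2 (Pplus_z u2) (Pplus_z (L2a u2)) => x.
by rewrite !fE => -> ->; ring.
Qed.

(** Expanding an analytic F as sum al^k f_k with f_k in the model space, and u as
    F / (1 - lam conj al), the projection of u is sum lam^k f_k: it agrees with F
    up to a multiple of al - lam. *)
Lemma Pa_lam (lam : C) u : L 2%:E u -> H2 ((1 - cst lam * conjf al) * u) ->
  aeq (Pa u) ((1 - cst lam * conjf al) * u - (al - cst lam) * Pplus (conjf al * u)).
Proof.
move=> u2 Hu; have au2 := L2a u2.
have [Hp Hq] := Pplus_spec au2.
have [Hp' Hq'] := Pplus_spec u2.
have k : aeq (Pplus ((1 - cst lam * conjf al) * u)) (Pplus u - cst lam * Pplus (conjf al * u)).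
  apply: (@PplusE _ _ _ (Pminus u - cst lam * Pminus (conjf al * u))).
  - exact: H2_L2.
  - by apply: H2B => //; exact: H2Z.
  - by apply: HmB => //; exact: HmZ.
  - by apply: aeW => x; rewrite /Pminus !fE; ring.
apply: filterS2 k (Pplus_H2 Hu) => x e1 e2.
move: e1; rewrite e2 /Pa !fE => ->; ring.
Qed.

(** If psi is not analytic and one of the products (b al - a) psi with b != 0 is,
    then subtracting multiples of that one shows that all the pairs (a, b) in P lie
    on the line a = lam b. Moreover |lam| < 1, since otherwise al - lam, which is
    -lam (1 - al / lam), could be divided out of (al - lam) psi. *)
Lemma pencil (psi : T -> C) (P : C -> C -> Prop) :
  nonconstant al -> L +oo%E psi ->
  (forall a b, P a b -> H2 ((cst b * al - cst a) * psi)) ->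
  [\/ H2 psi, forall a b, P a b -> a = 0 /\ b = 0
    | exists lam : C, [/\ `|lam| < 1, H2 ((al - cst lam) * psi) &
        forall a b, P a b -> a = lam * b]].
Proof.
move=> nal psio HP.
have [Hpsi|Npsi] := pselect (H2 psi); first by constructor 1.
have scal (a : C) : H2 (cst a * psi) -> a = 0.
  move=> Ha; apply/eqP/negP => /negP a0; apply: Npsi.
  have -> : psi = cst a^-1 * (cst a * psi).
    by apply: funext => x; rewrite !fE mulrA mulVf// mul1r.
  exact: H2Z.
have [b0|/existsNP[a /existsNP[b /not_implyP[Pab /eqP b0]]]] :=
    pselect (forall a b, P a b -> b = 0).
  constructor 2 => a b Pab; have be := b0 _ _ Pab; split => //.
  have := HP _ _ Pab; rewrite be => h; apply/eqP; rewrite -oppr_eq0; apply/eqP.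
  apply: scal; move: h; congr (H2 (_ * _)).
  by apply: funext => x; rewrite !fE mul0r sub0r.
constructor 3; exists (a / b).
have Hlam : H2 ((al - cst (a / b)) * psi).
  have -> : (al - cst (a / b)) * psi = cst b^-1 * ((cst b * al - cst a) * psi).
    by apply: funext => x; rewrite !fE; field.
  by apply: H2Z; exact: HP.
split => //.
- rewrite normC_lt1 ltNge; apply/negP => lam1; apply: Npsi.
  have l0 : a / b != 0.
    by apply/eqP => l0; move: lam1; rewrite l0 nsq0; lra.
  apply: (@inner_div (a / b)^-1) => //; last first.
  + have -> : (1 - cst (a / b)^-1 * al) * psi = cst (- (a / b)^-1) * ((al - cst (a / b)) * psi).
      apply: funext => x; rewrite !fE.
      have -> : 1 = (a / b)^-1 * (a / b) by rewrite mulVf.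
      ring.
    exact: H2Z.
  + exact: Loo_L2.
  + have : nsq (a / b)^-1 * nsq (a / b) = 1 by rewrite -nsqM mulVf// nsq1.
    by move: lam1 (nsq_ge0 (a / b)^-1); move: (nsq (a / b)^-1) (nsq (a / b)) => s t; nra.
- move=> a' b' Pab'; apply/eqP; rewrite -subr_eq0 -oppr_eq0 opprB; apply/eqP; apply: scal.
  have -> : cst (a / b * b' - a') * psi =
     (cst b' * al - cst a') * psi - cst b' * ((al - cst (a / b)) * psi).
    by apply: funext => x; rewrite !fE; ring.
  by apply: H2B; [exact: HP|exact: H2Z].
Qed.

End one_inner.

End inner_functions.

(** * Products of the operators *)

Section products.
Context {R : realType}.
Local Notation C := R[i].
Local Notation T := (circle R).
Local Notation m := (circle_measure R).
Implicit Types f g h u v w : T -> C.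

Lemma cJ1 : (1 : C)^*%C = 1. Proof. exact: conjc1. Qed.
Definition cJE := (@cJM R, @cJD R, @cJN R, @conjcK R, cJ1).

Lemma zf1 (x : T) : zf x * (zf x)^*%C = 1. Proof. exact: zJz. Qed.

Lemma L2Jf f : L 2%:E f -> L 2%:E (Jf f).
Proof. by move=> f2; apply: L2M; [exact/LooJ/Loo_z|exact: L2J]. Qed.

Lemma fourier_conj_test f : L 2%:E f ->
  (forall g, Hm g -> fourier (f * g) 0 = 0) -> H2 (conjf f).
Proof.
move=> f2 f0; split; first exact: L2J.
move=> n n0; rewrite fourier_conj// -[- n]add0r -fourier_shift fmulC f0 ?conjc0//.
exact: Hm_zn.
Qed.

Lemma fourier_test f : L 2%:E f ->
  (forall h, H2 h -> fourier (zf * (f * h)) 0 = 0) -> H2 f.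
Proof.
move=> f2 f0; split => // n n0.
have -> : fourier f n = fourier (zf * (f * zn (- n - 1))) 0.
  have -> : zf * (f * zn (- n - 1)) = zn (- n) * f.
    rewrite (fmulC f) mulrA -zn1 -znD; congr (zn _ * f); ring.
  by rewrite fourier_shift sub0r opprK.
by apply: f0; apply: H2_zn; lia.
Qed.

(** Membership in the model space of be, as H^2 meets be conj (z H^2). *)
Definition model be w := H2 w /\ Hm (conjf be * w).

Lemma model_aeq be f g : aeq f g -> cmeasurable be -> cmeasurable g ->
  model be f -> model be g.
Proof.
move=> fg mbe mg [Hf Hf']; split; first exact: H2_aeq fg mg Hf.
apply: (Hm_aeq _ _ Hf'); last by apply: cmeasM => //; exact: cmeasJ.
by apply: filterS fg => x; rewrite !fE => ->.
Qed.

Lemma modelD be f g : model be f -> model be g -> model be (f + g).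
Proof.
move=> [Hf Hf'] [Hg Hg']; split; first exact: H2D.
by rewrite mulrDr; exact: HmD.
Qed.

Lemma modelN be f : model be f -> model be (- f).
Proof.
move=> [Hf Hf']; split; first exact: H2N.
by rewrite mulrN; exact: HmN.
Qed.

Section three_inner.
Variables al be th : T -> C.
Hypotheses (hal : inner_fun al) (hbe : inner_fun be) (hth : inner_fun th).
Hypothesis nal : nonconstant al.

Let alo := inner_Loo hal.
Let beo := inner_Loo hbe.
Let tho := inner_Loo hth.
Let al1 := inner_mulJ hal.
Let be1 := inner_mulJ hbe.
Let th1 := inner_mulJ hth.

Local Ltac loo := lazymatch goal with
  | |- L _ (@GRing.mul _ _ _) => apply: LooM; loo
  | |- L _ (@GRing.add _ _ _) => apply: LooD; loo
  | |- L _ (@GRing.opp _ _) => apply: LooN; loo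
  | |- L _ (conjf _) => apply: LooJ; loo
  | |- L _ (cst _) => exact: Loo_cst
  | |- L _ zf => exact: Loo_z
  | |- L _ (@GRing.one _) => exact: Loo1
  | |- _ => assumption
  end.
Local Ltac l2 := lazymatch goal with
  | |- L _ (@GRing.mul _ _ _) => solve [apply: L2M; [solve [loo]|l2]
                                       | apply: Loo_L2; solve [loo]]
  | |- L _ (@GRing.add _ _ _) => apply: L2D; l2
  | |- L _ (@GRing.opp _ _) => apply: L2N; l2
  | |- L _ (conjf _) => apply: L2J; l2
  | |- L _ (Jf _) => apply: L2Jf; l2
  | |- L _ (Pa _ _) => apply: (Pa_L2 hal); l2
  | |- _ => solve [assumption | apply: H2_L2; assumption | apply: Hm_L2; assumption
                  | apply: Loo_L2; solve [loo]]
  end.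
Local Ltac cms := lazymatch goal with
  | |- cmeasurable (@GRing.mul _ _ _) => apply: cmeasM; cms
  | |- cmeasurable (@GRing.add _ _ _) => apply: cmeasD; cms
  | |- cmeasurable (@GRing.opp _ _) => apply: cmeasN; cms
  | |- cmeasurable (conjf _) => apply: cmeasJ; cms
  | |- _ => solve [assumption | apply: Loo_cmeas; solve [loo] | apply: L2_cmeas; l2]
  end.

Section commutator.
Variables phi psi tau : T -> C.
Hypotheses (phio : L +oo%E phi) (psio : L +oo%E psi) (tauo : L +oo%E tau).

(** Write w(g) for the function supposed to be analytic. In w(g) - z w(conj z g)
    the symbol tau drops out and the commutator of the model projection with the
    shift leaves psi (b al - a), where a and b are the means of phi g and of
    conj al phi g. If psi is not analytic, then a = lam b for all g, with lam = 0
    allowed; that says that (1 - conj lam al) conj phi is analytic, and the first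
    factor divides out. *)
Lemma product_on_Hm_cases :
  (forall g, Hm g -> H2 (tau * g - psi * Pa al (phi * g))) ->
  H2 psi \/ H2 (conjf phi).
Proof.
move=> HW.
pose P a b := exists g, [/\ Hm g, a = fourier (phi * g) 0
                         & b = fourier (conjf al * (phi * g)) 0].
have HP a b : P a b -> H2 ((cst b * al - cst a) * psi).
  move=> [g [Hg -> ->]].
  have Hg' : Hm (conjf zf * g) by exact: HmM (Hinf_zf) Hg.
  have u2 : L 2%:E (phi * (conjf zf * g)) by l2.
  have zu : zf * (phi * (conjf zf * g)) = phi * g.
    by apply: funext => x; have e := zf1 x; rewrite !fE; ring: e.
  have H : H2 ((tau * g - psi * Pa al (phi * g)) -
      zf * (tau * (conjf zf * g) - psi * Pa al (phi * (conjf zf * g)))).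
    by apply: H2B; [exact: HW|apply: H2M (Hinf_zf) _; exact: HW].
  apply: (H2_aeq _ _ H); last by cms.
  have := Pa_z hal u2; rewrite zu; apply: filterS => x.
  rewrite !fE => e; have ez := zf1 x.
  transitivity ((zf x * Pa al (phi * (conjf zf * g)) x - Pa al (phi * g) x) * psi x).
    by move: (Pa al _ x) (Pa al (phi * g) x) => A B; ring: ez.
  exact: (congr1 (fun c => c * psi x) e).
have [Hpsi|ab0|[lam [lam1 _ ab]]] := pencil hal nal psio HP.
- by left.
- right; apply: fourier_conj_test; first by l2.
  move=> g Hg; have /ab0[-> //] : P (fourier (phi * g) 0) (fourier (conjf al * (phi * g)) 0).
  by exists g.
- right; apply: (inner_div hal nal (mu := lam^*%C)).
  + by move: lam1; rewrite nsqJ normC_lt1; exact: ltW.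
  + by l2.
  + have -> : (1 - cst lam^*%C * al) * conjf phi = conjf (phi - cst lam * (conjf al * phi)).
      by apply: funext => x; rewrite !fE !cJE; ring.
    apply: fourier_conj_test; first by l2.
    move=> g Hg.
    have -> : (phi - cst lam * (conjf al * phi)) * g =
        phi * g - cst lam * (conjf al * (phi * g)).
      by apply: funext => x; rewrite !fE; ring.
    have pg2 : L 2%:E (phi * g) by l2.
    have apg2 : L 2%:E (conjf al * (phi * g)) by l2.
    rewrite fourierB//; last by l2.
    by rewrite fourierZ// (ab (fourier (phi * g) 0) (fourier (conjf al * (phi * g)) 0)) ?subrr//; exists g.
Qed.

(** The complement of H^2 alone identifies the symbol: as psi or conj phi is
    analytic, psi P_al (phi g) is analytic for all g in that complement, so tau
    multiplies the complement into H^2. Testing on z^n with n -> -oo, all the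
    coefficients of tau vanish. *)
Lemma product_symbol :
  (forall g, Hm g -> H2 (tau * g - psi * Pa al (phi * g))) -> aeq tau 0.
Proof.
move=> HW.
have tH g : Hm g -> H2 (tau * g).
  move=> Hg; have pg2 : L 2%:E (phi * g) by l2.
  have [Hpsi|Hphi] := product_on_Hm_cases HW.
    have -> : tau * g = (tau * g - psi * Pa al (phi * g)) + psi * Pa al (phi * g).
      by apply: funext => x; rewrite !fE; ring.
    by apply: H2D; [exact: HW|apply: H2M => //; exact: Pa_H2].
  apply: (H2_aeq _ _ (HW _ Hg)); last by cms.
  have Hpg : Hm (phi * g).
    rewrite -(conjfK phi); apply: HmM => //; split => //; loo.
  by apply: filterS (Pa_Hm0 hal Hpg) => x; rewrite !fE => ->; ring.
apply: fourier_inj; first by l2.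
move=> k; pose n : int := - (`|k|%N%:Z + 1).
have [_ /(_ (k + n))] : H2 (tau * zn n) by apply/tH/Hm_zn; rewrite /n; lia.
by rewrite fmulC fourier_shift addrK; apply; rewrite /n; lia.
Qed.

End commutator.

Section symbols.
Variables phi psi : T -> C.
Hypotheses (phio : L +oo%E phi) (psio : L +oo%E psi).

(** The two halves of the condition that psi P_al (phi x) lies in the model
    space of be for x in the complement of the model space of th. *)
Definition condA phi psi := forall g, Hm g -> model be (psi * Pa al (phi * g)).
Definition condB phi psi := forall h, H2 h -> model be (psi * Pa al (phi * (th * h))).

(** The commutator argument again, this time on th H^2 with g replaced by th h and
    conj z by z. In the last alternative the products with psi are analytic because
    P_al (phi th) differs from (1 - lam conj al) th phi by a multiple of
    al - lam. *)
Lemma condB_cases : condB phi psi ->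
  [\/ H2 psi, H2 (th * conjf al * phi)
    | exists lam : C, [/\ `|lam| < 1, H2 ((al - cst lam) * psi),
        H2 ((1 - cst lam * conjf al) * th * phi)
      & H2 ((1 - cst lam * conjf al) * th * phi * psi)]].
Proof.
move=> HB.
pose P a b := exists h, [/\ H2 h, a = fourier (zf * (phi * (th * h))) 0
                         & b = fourier (conjf al * (zf * (phi * (th * h)))) 0].
have HP a b : P a b -> H2 ((cst b * al - cst a) * psi).
  move=> [h [Hh -> ->]].
  have Hzh : H2 (zf * h) by exact: H2M (Hinf_zf) Hh.
  have u2 : L 2%:E (phi * (th * h)) by l2.
  have zu : zf * (phi * (th * h)) = phi * (th * (zf * h)).
    by apply: funext => x; rewrite !fE; ring.
  have H : H2 (zf * (psi * Pa al (phi * (th * h))) - psi * Pa al (phi * (th * (zf * h)))).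
    by apply: H2B; [apply: H2M (Hinf_zf) _; case: (HB _ Hh)|case: (HB _ Hzh)].
  have zu2 : L 2%:E (zf * (phi * (th * h))) by l2.
  apply: (H2_aeq _ _ H); last by cms.
  have := Pa_z hal u2; rewrite zu; apply: filterS => x; rewrite !fE => e.
  transitivity ((zf x * Pa al (phi * (th * h)) x - Pa al (phi * (th * (zf * h))) x) * psi x).
    by move: (Pa al (phi * (th * h)) x) (Pa al _ x) => A B; ring.
  exact: (congr1 (fun c => c * psi x) e).
have [Hpsi|ab0|[lam [lam1 Hlam ab]]] := pencil hal nal psio HP.
- by constructor 1.
- constructor 2; apply: fourier_test; first by l2.
  move=> h Hh; have -> : zf * (th * conjf al * phi * h) =
      conjf al * (zf * (phi * (th * h))) by apply: funext => x; rewrite !fE; ring.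
  by have /ab0[_ ->] : P (fourier (zf * (phi * (th * h))) 0)
     (fourier (conjf al * (zf * (phi * (th * h)))) 0) by exists h.
- have HF : H2 ((1 - cst lam * conjf al) * th * phi).
    apply: fourier_test; first by l2.
    move=> h Hh.
    have -> : zf * ((1 - cst lam * conjf al) * th * phi * h) =
        zf * (phi * (th * h)) - cst lam * (conjf al * (zf * (phi * (th * h)))).
      by apply: funext => x; rewrite !fE; ring.
    have pg2 : L 2%:E (zf * (phi * (th * h))) by l2.
    have apg2 : L 2%:E (conjf al * (zf * (phi * (th * h)))) by l2.
    rewrite fourierB//; last by l2.
    rewrite fourierZ// (ab (fourier (zf * (phi * (th * h))) 0)
      (fourier (conjf al * (zf * (phi * (th * h)))) 0)) ?subrr//.
    by exists h.
  constructor 3; exists lam; split; [exact: lam1|exact: Hlam|exact: HF|].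
  have [HB1 _] := HB _ (H2_cst 1).
  set u := phi * (th * cst 1) in HB1.
  have u2 : L 2%:E u by rewrite /u; l2.
  have HFu : H2 ((1 - cst lam * conjf al) * u).
    have -> : (1 - cst lam * conjf al) * u = (1 - cst lam * conjf al) * th * phi.
      by apply: funext => x; rewrite /u !fE; ring.
    exact: HF.
  have au2 : L 2%:E (conjf al * u) by l2.
  have Hq := H2_Pplus au2.
  have Hlo : Hinf ((al - cst lam) * psi) by split => //; loo.
  have H : H2 (psi * Pa al u + (al - cst lam) * psi * Pplus (conjf al * u)).
    by apply: (H2D HB1); exact: (H2M Hlo Hq).
  apply: (H2_aeq _ _ H); last by cms.
  apply: filterS (Pa_lam hal u2 HFu) => x; rewrite !fE => ->.
  by rewrite /u !fE; ring.
Qed.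

Lemma suff_outer : Hinf psi -> Hinf (conjf al * be * conjf psi) ->
  forall u, L 2%:E u -> model be (psi * Pa al u).
Proof.
move=> Hpsi Hpsi' u u2; split; first by apply: H2M => //; exact: Pa_H2.
apply: (Hm_aeq _ _ (HmM Hpsi' (Pa_Hm hal u2))); last by cms.
by apply: filterS al1 => x e; rewrite !fE !cJE; ring: e.
Qed.

Lemma model0 u : L 2%:E u -> aeq (Pa al u) 0 -> model be (psi * Pa al u).
Proof.
move=> u2 e; have H : model be (cst 0).
  split; first exact: H2_cst.
  have -> : conjf be * cst 0 = cst 0 * Jf 1 by apply: funext => x; rewrite !fE mulr0 mul0r.
  by apply: HmZ; apply: Jf_H2; exact: (H2_cst 1).
apply: model_aeq H; [|cms|cms].
by apply: filterS e => x; rewrite !fE => ->; rewrite mulr0.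
Qed.

Lemma suff_inner : Hinf (conjf phi) -> Hinf (th * conjf al * phi) ->
  condA phi psi /\ condB phi psi.
Proof.
move=> Hphi Hphi'; split => [g Hg|h Hh]; (apply: model0; first by l2).
  by apply: (Pa_Hm0 hal); rewrite -(conjfK phi); exact: HmM.
apply: (Pa_alH2 hal); first by l2.
have -> : conjf al * (phi * (th * h)) = th * conjf al * phi * h.
  by apply: funext => x; rewrite !fE; ring.
exact: H2M.
Qed.

(** By Pa_lam the projection of phi th h is (1 - lam conj al) phi th h minus a
    multiple of al - lam, and psi maps both terms into H^2; the model space is
    then reached because conj al be conj psi is analytic. *)
Lemma suff_lam (lam : C) : Hinf (conjf phi) ->
  Hinf ((1 - cst lam * conjf al) * th * phi) ->
  Hinf (conjf al * be * conjf psi) -> Hinf ((al - cst lam) * psi) ->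
  Hinf ((1 - cst lam * conjf al) * th * phi * psi) ->
  condA phi psi /\ condB phi psi.
Proof.
move=> Hphi HF Hpsi' Hlam HFpsi; split => [g Hg|h Hh].
  apply: model0; first by l2.
  by apply: (Pa_Hm0 hal); rewrite -(conjfK phi); exact: HmM.
set u := phi * (th * h); have u2 : L 2%:E u by rewrite /u; l2.
have au2 : L 2%:E (conjf al * u) by l2.
have Hq := H2_Pplus au2.
split; last first.
  apply: (Hm_aeq _ _ (HmM Hpsi' (Pa_Hm hal u2))); last by cms.
  by apply: filterS al1 => x e; rewrite !fE !cJE; ring: e.
have HFu : H2 ((1 - cst lam * conjf al) * u).
  have -> : (1 - cst lam * conjf al) * u = (1 - cst lam * conjf al) * th * phi * h.
    by apply: funext => x; rewrite /u !fE; ring.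
  exact: H2M.
have H : H2 ((1 - cst lam * conjf al) * th * phi * psi * h
             - (al - cst lam) * psi * Pplus (conjf al * u)).
  by apply: H2B; exact: H2M.
apply: (H2_aeq _ _ H); last by cms.
apply: filterS (Pa_lam hal u2 HFu) => x; rewrite !fE => ->.
by rewrite /u !fE; ring.
Qed.

End symbols.

(** Since u |-> conj (z u) exchanges P_+ and P_-, and al has modulus 1, the
    conjugation u |-> al conj (z u) preserves the model space. *)
Lemma Pa_conj u : L 2%:E u -> aeq (Pa al (al * Jf u)) (al * Jf (Pa al u)).
Proof.
move=> u2; have au2 : L 2%:E (conjf al * u) by l2.
have Pj v : L 2%:E v -> aeq (Pplus (Jf v)) (Jf (Pminus v)).
  move=> v2; have [Hp Hq] := Pplus_spec v2.
  apply: (PplusE _ (Jf_Hm Hq) (Jf_H2 Hp)).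
    by l2.
  by apply: aeW => x; rewrite /Jf /Pminus !fE !cJE; ring.
have J2 : L 2%:E (Jf u) by l2.
have alJ2 : L 2%:E (conjf al * (al * Jf u)) by l2.
have e1 : al * Jf u = Jf (conjf al * u).
  by apply: funext => x; rewrite /Jf !fE !cJE; ring.
have e2 : aeq (Pplus (conjf al * (al * Jf u))) (Pplus (Jf u)).
  by apply: Pplus_aeq => //; apply: filterS al1 => x e; rewrite !fE; ring: e.
have k1 := Pj _ u2; have k2 := Pj _ au2; rewrite -e1 in k2.
have k3 := PaE hal u.
have k4 := aeq_trans e2 k1.
have k5 : \forall x \ae m, al x * (al x)^*%C = 1 /\
    Pa al u x = (al * Pminus (conjf al * u) - Pminus u) x.
  by apply: filterS2 al1 k3.
apply: (filterS3 _ _ k2 k4 k5) => x h1 h2 [e h3].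
rewrite /Pa !fE h1 h2 -[al x * Jf (Pa al u) x]/(al x * ((zf x)^*%C * (Pa al u x)^*%C)) h3.
by rewrite /Jf !fE !cJE; ring: e.
Qed.

(** The pair (dphi phi, dpsi psi) is obtained by conjugating the operators with the
    conjugations u |-> th conj (z u), al conj (z u) and be conj (z u), each of which
    preserves its model space and exchanges the two summands, th H^2 and the
    complement of H^2 for the first one, of the complement of that space. This
    duality swaps condA with condB, and the third alternative of the theorem with
    the fourth one. *)
Definition dphi (phi : T -> C) := al * conjf th * conjf phi.
Definition dpsi (psi : T -> C) := conjf al * be * conjf psi.

Lemma model_conj psi u w : L +oo%E psi -> L 2%:E u -> L 2%:E w ->
  aeq w (al * Jf u) -> model be (psi * Pa al u) -> model be (dpsi psi * Pa al w).
Proof.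
move=> psio u2 w2 wu [Hu Hu'].
have Ju2 : L 2%:E (Jf u) by l2.
have aJu2 : L 2%:E (al * Jf u) by l2.
have JPu2 : L 2%:E (Jf (Pa al u)) by l2.
have JpPu2 : L 2%:E (Jf (psi * Pa al u)) by l2.
have dpsio : L +oo%E (dpsi psi) by rewrite /dpsi; loo.
have H : model be (be * Jf (psi * Pa al u)).
  split.
    have -> : be * Jf (psi * Pa al u) = Jf (conjf be * (psi * Pa al u)).
      by apply: funext => x; rewrite /Jf !fE !cJE; ring.
    exact: Jf_Hm.
  apply: (Hm_aeq _ _ (Jf_H2 Hu)); last by cms.
  by apply: filterS be1 => x e; rewrite !fE; ring: e.
apply: model_aeq H; [|cms|cms].
apply: (filterS3 _ _ al1 (Pa_aeq hal w2 aJu2 wu) (Pa_conj u2)) => x e h1 h2.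
rewrite /dpsi !fE h1 h2 /Jf !fE !cJE; ring: e.
Qed.

Lemma condA_dual phi psi : L +oo%E phi -> L +oo%E psi ->
  condA phi psi -> condB (dphi phi) (dpsi psi).
Proof.
move=> phio psio HA h Hh.
have dphio : L +oo%E (dphi phi) by rewrite /dphi; loo.
have Hg := Jf_H2 Hh.
apply: (model_conj psio (u := phi * Jf h)); [l2|l2| |exact: HA].
apply: filterS th1 => x e; have ez := zf1 x.
rewrite /dphi /Jf !fE !cJE; ring: e ez.
Qed.

Lemma condB_dual phi psi : L +oo%E phi -> L +oo%E psi ->
  condB phi psi -> condA (dphi phi) (dpsi psi).
Proof.
move=> phio psio HB g Hg.
have dphio : L +oo%E (dphi phi) by rewrite /dphi; loo.
have Hh := Jf_Hm Hg.
apply: (model_conj psio (u := phi * (th * Jf g))); [l2|l2| |exact: HB].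
apply: aeW => x; have ez := zf1 x.
rewrite /dphi /Jf !fE !cJE; ring: ez.
Qed.

Lemma cond_aeq phi phi' psi psi' : L +oo%E phi -> L +oo%E phi' ->
  L +oo%E psi -> L +oo%E psi' -> aeq phi phi' -> aeq psi psi' ->
  condA phi psi /\ condB phi psi -> condA phi' psi' /\ condB phi' psi'.
Proof.
move=> o1 o2 o3 o4 ephi epsi [HA HB].
have key u u' : L 2%:E u -> L 2%:E u' -> aeq u u' ->
    model be (psi * Pa al u) -> model be (psi' * Pa al u').
  move=> u2 u2' uu; apply: model_aeq; [|cms|cms].
  by apply: filterS2 epsi (Pa_aeq hal u2 u2' uu) => x; rewrite !fE => -> ->.
split => [g Hg|h Hh].
  apply: (key (phi * g)); [l2|l2| |exact: HA].
  by apply: filterS ephi => x; rewrite !fE => ->.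
apply: (key (phi * (th * h))); [l2|l2| |exact: HB].
by apply: filterS ephi => x; rewrite !fE => ->.
Qed.

Lemma cond_undual phi psi : L +oo%E phi -> L +oo%E psi ->
  condA (dphi phi) (dpsi psi) /\ condB (dphi phi) (dpsi psi) ->
  condA phi psi /\ condB phi psi.
Proof.
move=> phio psio [HA HB].
have dphio : L +oo%E (dphi phi) by rewrite /dphi; loo.
have dpsio : L +oo%E (dpsi psi) by rewrite /dpsi; loo.
have := conj (condB_dual dphio dpsio HB) (condA_dual dphio dpsio HA).
apply: cond_aeq => //; first by rewrite /dphi; loo.
- by rewrite /dpsi; loo.
- by apply: filterS2 al1 th1 => x e1 e2; rewrite /dphi !fE !cJE; ring: e1 e2.
- by apply: filterS2 al1 be1 => x e1 e2; rewrite /dpsi !fE !cJE; ring: e1 e2.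
Qed.

(** On the circle conj al - conj lam = (1 - conj lam al) conj al, and the first
    factor is analytic and can be divided out. *)
Lemma mulr_lamJ (lam : C) f : `|lam| < 1 -> L +oo%E f ->
  Hinf ((conjf al - cst (conjc lam)) * f) <-> Hinf (conjf al * f).
Proof.
move=> lam1 fo.
have Hlam : Hinf (1 - cst lam^*%C * al).
  apply: HinfB; first exact: (Hinf_cst 1).
  by apply: HinfM; [exact: Hinf_cst|exact: inner_Hinf].
have e : aeq ((conjf al - cst (conjc lam)) * f) ((1 - cst lam^*%C * al) * (conjf al * f)).
  by apply: filterS al1 => x e; rewrite !fE; ring: e.
split => H; last first.
  apply: (Hinf_aeq (aeq_sym e)); first by cms.
  exact: HinfM.
have afo : L +oo%E (conjf al * f) by loo.
split; first exact: afo.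
apply: (inner_div hal nal (mu := lam^*%C)).
- by move: lam1; rewrite nsqJ normC_lt1; exact: ltW.
- exact: Loo_L2.
- by apply: (H2_aeq e); [cms|case: H].
Qed.

(** The commutator argument applied to the condition and to its dual shows that
    psi or conj phi is analytic and that dpsi or conj dphi is analytic. The two
    diagonal cases are the first two alternatives, the two others are settled by
    condB_cases, applied to the pair or to its dual. *)
Lemma cond_iff phi psi : L +oo%E phi -> L +oo%E psi ->
  condA phi psi /\ condB phi psi <->
  [\/ Hinf psi /\ Hinf (conjf al * be * conjf psi),
      Hinf (conjf phi) /\ Hinf (th * conjf al * phi),
      exists lambda : C, `|lambda| < 1 /\
        [/\ Hinf (conjf phi),
            Hinf ((1 - cst lambda * conjf al) * th * phi),
            Hinf ((conjf al - cst (conjc lambda)) * be * conjf psi),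
            Hinf ((al - cst lambda) * psi)
          & Hinf ((1 - cst lambda * conjf al) * th * phi * psi)]
    | exists lambda : C, `|lambda| < 1 /\
        [/\ Hinf psi,
            Hinf ((1 - cst lambda * conjf al) * be * conjf psi),
            Hinf ((conjf al - cst (conjc lambda)) * th * phi),
            Hinf ((al - cst lambda) * conjf phi)
          & Hinf ((1 - cst lambda * conjf al) * be * conjf phi
                    * conjf psi)]].
Proof.
move=> phio psio.
have dphio : L +oo%E (dphi phi) by rewrite /dphi; loo.
have dpsio : L +oo%E (dpsi psi) by rewrite /dpsi; loo.
have tpo : L +oo%E (th * phi) by loo.
have bpo : L +oo%E (be * conjf psi) by loo.
have cdphi : conjf (dphi phi) = conjf al * (th * phi).
  by apply: funext => x; rewrite /dphi !fE !cJE; ring.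
have tap : th * conjf al * phi = conjf al * (th * phi).
  by apply: funext => x; rewrite !fE; ring.
have e1 lam : aeq ((al - cst lam) * dpsi psi) ((1 - cst lam * conjf al) * be * conjf psi).
  by apply: filterS al1 => x e; rewrite /dpsi !fE; ring: e.
have e2 lam : aeq ((1 - cst lam * conjf al) * th * dphi phi) ((al - cst lam) * conjf phi).
  by apply: filterS2 al1 th1 => x e e'; rewrite /dphi !fE; ring: e e'.
have e3 lam : aeq ((1 - cst lam * conjf al) * th * dphi phi * dpsi psi)
    ((1 - cst lam * conjf al) * be * conjf phi * conjf psi).
  by apply: filterS2 al1 th1 => x e e'; rewrite /dphi /dpsi !fE; ring: e e'.
have e4 : aeq (conjf al * be * conjf (dpsi psi)) psi.
  by apply: filterS2 al1 be1 => x e e'; rewrite /dpsi !fE !cJE; ring: e e'.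
have e5 : aeq (th * conjf al * dphi phi) (conjf phi).
  by apply: filterS2 al1 th1 => x e e'; rewrite /dphi !fE; ring: e e'.
have HA0 p q : L +oo%E p -> L +oo%E q -> condA p q -> H2 q \/ H2 (conjf p).
  move=> po qo HA; apply: (@product_on_Hm_cases p q (cst 0)) => //; try exact: Loo_cst.
  move=> g Hg; have [H _] := HA _ Hg.
  have -> : cst 0 * g - q * Pa al (p * g) = - (q * Pa al (p * g)).
    by apply: funext => x; rewrite !fE mul0r add0r.
  exact: H2N.
split.
  move=> [HA HB].
  have [HAd HBd] : condA (dphi phi) (dpsi psi) /\ condB (dphi phi) (dpsi psi).
    by split; [exact: (condB_dual phio psio HB)|exact: (condA_dual phio psio HA)].
  have d1 := HA0 _ _ phio psio HA; have d2 := HA0 _ _ dphio dpsio HAd.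
  have [Hpsi|Hphi] := d1; have [Hpsi'|Hphi'] := d2.
  - by constructor 1.
  - have [||] := condB_cases dphio dpsio HBd.
    + by move=> H; constructor 1.
    + move=> H; constructor 2; split; last first.
        by rewrite tap -cdphi; split; [exact: LooJ|exact: Hphi'].
      by split; [loo|apply: (H2_aeq e5 _ H); cms].
    + move=> [lam [lam1 H1 H3 H4]]; constructor 4; exists lam; split; first exact: lam1.
      split.
      * by split; [exact: psio|exact: Hpsi].
      * by split; [loo|apply: (H2_aeq (e1 lam) _ H1); cms].
      * rewrite -mulrA; apply/(mulr_lamJ lam1 tpo); rewrite -cdphi.
        by split; [exact: LooJ|exact: Hphi'].
      * by split; [loo|apply: (H2_aeq (e2 lam) _ H3); cms].
      * by split; [loo|apply: (H2_aeq (e3 lam) _ H4); cms].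
  - have [||] := condB_cases phio psio HB.
    + by move=> H; constructor 1.
    + by move=> H; constructor 2; split; split; [loo|exact: Hphi|loo|exact: H].
    + move=> [lam [lam1 H1 H3 H4]]; constructor 3; exists lam; split; first exact: lam1.
      split.
      * by split; [loo|exact: Hphi].
      * by split; [loo|exact: H3].
      * rewrite -mulrA; apply/(mulr_lamJ lam1 bpo); rewrite mulrA.
        by split; [exact: dpsio|exact: Hpsi'].
      * by split; [loo|exact: H1].
      * by split; [loo|exact: H4].
  - constructor 2; split; first by split; [loo|exact: Hphi].
    by rewrite tap -cdphi; split; [exact: LooJ|exact: Hphi'].
case.
- move=> [Hpsi Hpsi']; split => [g Hg|h Hh]; apply: suff_outer => //; l2.
- by move=> [Hphi Hphi']; exact: (suff_inner phio psio Hphi Hphi').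
- move=> [lam [lam1 [H1 H3 H4 H5 H6]]]; apply: (suff_lam phio psio H1 H3 _ H5 H6).
  by move: H4; rewrite -mulrA => /(mulr_lamJ lam1 bpo); rewrite mulrA.
- move=> [lam [lam1 [H1 H3 H4 H5 H6]]]; apply: (cond_undual phio psio).
  apply: (suff_lam dphio dpsio (lam := lam)).
  + by rewrite cdphi; apply/(mulr_lamJ lam1 tpo); rewrite mulrA.
  + by apply: (Hinf_aeq (aeq_sym (e2 lam)) _ H5); cms.
  + by apply: (Hinf_aeq (aeq_sym e4) _ H1); cms.
  + by apply: (Hinf_aeq (aeq_sym (e1 lam)) _ H3); cms.
  + by apply: (Hinf_aeq (aeq_sym (e3 lam)) _ H6); cms.
Qed.

End three_inner.

End products.

(** * The operators on the complements of the model spaces *)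

Section operators.
Context {R : realType}.
Local Notation C := R[i].
Local Notation T := (circle R).
Local Notation m := (circle_measure R).
Implicit Types f g h u v w x : T -> C.

Lemma K_model (th k : T -> C) : inner_fun th -> K th k <-> model th k.
Proof.
move=> hth; split=> -[Hk kP]; split => //.
  split; first by apply: L2M; [exact: inner_LooJ|exact: H2_L2].
  move=> n n0; rewrite fourierE ipM conjfK; apply: kP.
  by exists (zn n) => //; exact: H2_zn.
move=> _ [h Hh <-]; rewrite -{1}(conjfK th) -ipM.
rewrite (ipC (H2_L2 Hh) (Hm_L2 kP)) H2_Hm_orth//; exact: conjc0.
Qed.

(** An x in the complement of the model space is orthogonal to its own model
    projection, which therefore vanishes. *)
Lemma Kperp_decomposition th x : inner_fun th -> Kperp th x ->
  exists h g, [/\ H2 h, Hm g & aeq x (th * h + g)].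
Proof.
move=> hth [x2 xK]; have tho := inner_Loo hth.
have tx2 : L 2%:E (conjf th * x) by apply: L2M => //; exact: inner_LooJ.
have [Hp Hq] := Pplus_spec x2; have [Hp' Hq'] := Pplus_spec tx2.
exists (Pplus (conjf th * x)), (Pminus x); split => //.
set k := Pa th x.
have k2 : L 2%:E k := Pa_L2 hth x2.
have kM : model th k by split; [exact: Pa_H2|exact: Pa_Hm].
have xE : x = k + (th * Pplus (conjf th * x) + Pminus x).
  by apply: funext => t; rewrite /k /Pa /Pminus !fE; ring.
have th2 : L 2%:E (th * Pplus (conjf th * x)) by apply: L2M => //; exact: H2_L2.
have := xK k (proj2 (K_model k hth) kM).
rewrite {1}xE ipDl//; last by apply: L2D => //; exact: Hm_L2.
rewrite (ipDl th2 (Hm_L2 Hq) k2).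
rewrite ipM (H2_Hm_orth Hp' (proj2 kM)) (ipC k2 (Hm_L2 Hq)).
rewrite (H2_Hm_orth (proj1 kM) Hq) conjc0 !addr0 => k0.
apply: filterS (ip_self0 k2 k0) => t kt.
by rewrite [in LHS]xE fE kt add0r.
Qed.

Lemma Kperp_intro th x h g : inner_fun th -> L 2%:E x -> H2 h -> Hm g ->
  aeq x (th * h + g) -> Kperp th x.
Proof.
move=> hth x2 Hh Hg xE; split => // k /(K_model k hth) [Hk Hk'].
have th2 : L 2%:E (th * h) by apply: L2M; [exact: inner_Loo|exact: H2_L2].
have hg2 := L2D th2 (Hm_L2 Hg).
rewrite (ip_aeq xE (aeq_refl k)); try exact: L2_cmeas; try exact/L2_cmeas/H2_L2.
rewrite ipDl//; [|exact: Hm_L2|exact: H2_L2].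
rewrite ipM (H2_Hm_orth Hh Hk') (ipC (H2_L2 Hk) (Hm_L2 Hg)) (H2_Hm_orth Hk Hg).
by rewrite conjc0 addr0.
Qed.

Lemma adttE th al phi x : Kperp th x ->
  adtt th al phi x = phi * x - Pa al (phi * x).
Proof.
move=> Kx; rewrite /adtt /patch mem_set//.
by apply: funext => t; rewrite /Pminus /Pa -mulrA !fE; ring.
Qed.

Lemma PaB al u v : inner_fun al -> L 2%:E u -> L 2%:E v ->
  aeq (Pa al (u - v)) (Pa al u - Pa al v).
Proof.
move=> hal u2 v2; have := PaD hal (L2B u2 v2) v2; rewrite subrK.
apply: filterS => t; rewrite !fE => ->.
by move: (Pa al _ t) (Pa al v t) => A B; ring.
Qed.

Lemma Pa_id be w : inner_fun be -> L 2%:E w -> aeq w (Pa be w) <-> model be w.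
Proof.
move=> hbe w2; split => [e|[Hw Hw']].
  apply: (@model_aeq _ be (Pa be w)); first exact: aeq_sym.
  - exact: inner_cmeas.
  - exact: L2_cmeas.
  - by split; [exact: Pa_H2|exact: Pa_Hm].
apply: filterS2 (Pplus_H2 Hw) (Pplus_Hm Hw') => t.
by rewrite /Pa !fE => -> ->; rewrite mulr0 subr0.
Qed.

(** As D_phi x = phi x - P (phi x) with P the projection onto the model space of
    al, the product formula at x says that this difference of functions is fixed
    by the projection onto the model space of be. *)
Lemma adtt_product al be th phi psi sigma x :
  inner_fun al -> inner_fun be -> inner_fun th ->
  L +oo%E phi -> L +oo%E psi -> L +oo%E sigma -> Kperp th x ->
  aeq (adtt al be psi (adtt th al phi x)) (adtt th be sigma x) <->
  model be ((phi * psi - sigma) * x - psi * Pa al (phi * x)).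
Proof.
move=> hal hbe hth phio psio sigo Kx; have [x2 _] := Kx.
have px2 : L 2%:E (phi * x) by exact: L2M.
have apx2 : L 2%:E (conjf al * (phi * x)) by apply: L2M => //; exact: inner_LooJ.
have [Hp Hq] := Pplus_spec px2; have [Hp' Hq'] := Pplus_spec apx2.
have y2 : L 2%:E (phi * x - Pa al (phi * x)) by apply: L2B => //; exact: Pa_L2.
have Ky : Kperp al (phi * x - Pa al (phi * x)).
  apply: (Kperp_intro hal y2 Hp' Hq); apply: aeW => t.
  by rewrite /Pa /Pminus !fE; ring.
rewrite !(adttE _ _ Kx) (adttE _ _ Ky).
set y := phi * x - _.
have ->: (phi * psi - sigma) * x - psi * Pa al (phi * x) = psi * y - sigma * x.
  by apply: funext => t; rewrite /y !fE; move: (Pa _ _ t) => A; ring.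
have py2 : L 2%:E (psi * y) by exact: L2M.
have sx2 : L 2%:E (sigma * x) by exact: L2M.
rewrite -(Pa_id hbe (L2B py2 sx2)).
have eB := PaB hbe py2 sx2.
split => e; apply: filterS2 eB e => t; rewrite !fE => h1 h2.
  rewrite h1; move: h2; move: (Pa be (psi * y) t) (Pa be (sigma * x) t) => A B h2.
  have -> : psi t * y t = psi t * y t - A + A by ring.
  by rewrite h2; ring.
rewrite h1 in h2; move: h2; move: (Pa be (psi * y) t) (Pa be (sigma * x) t) => A B h2.
have -> : psi t * y t = psi t * y t - sigma t * x t + sigma t * x t by ring.
by rewrite h2; ring.
Qed.

End operators.

Theorem theorem5p6 (R : realType)
  (phi psi sigma alpha beta theta : circle R -> R[i])
  (hphi : L +oo%E phi) (hpsi : L +oo%E psi) (hsigma : L +oo%E sigma)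
  (halpha : inner_fun alpha) (nalpha : nonconstant alpha)
  (hbeta : inner_fun beta) (nbeta : nonconstant beta)
  (htheta : inner_fun theta) (ntheta : nonconstant theta) :
  (forall x, Kperp theta x ->
     adtt alpha beta psi (adtt theta alpha phi x) = adtt theta beta sigma x
       %[ae circle_measure R])
  <->
  sigma = phi * psi %[ae circle_measure R] /\
  [\/ Hinf psi /\ Hinf (conjf alpha * beta * conjf psi),
      Hinf (conjf phi) /\ Hinf (theta * conjf alpha * phi),
      exists lambda : R[i], `|lambda| < 1 /\
        [/\ Hinf (conjf phi),
            Hinf ((1 - cst lambda * conjf alpha) * theta * phi),
            Hinf ((conjf alpha - cst (conjc lambda)) * beta * conjf psi),
            Hinf ((alpha - cst lambda) * psi)
          & Hinf ((1 - cst lambda * conjf alpha) * theta * phi * psi)]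
    | exists lambda : R[i], `|lambda| < 1 /\
        [/\ Hinf psi,
            Hinf ((1 - cst lambda * conjf alpha) * beta * conjf psi),
            Hinf ((conjf alpha - cst (conjc lambda)) * theta * phi),
            Hinf ((alpha - cst lambda) * conjf phi)
          & Hinf ((1 - cst lambda * conjf alpha) * beta * conjf phi
                    * conjf psi)]].
Proof.
set tau := phi * psi - sigma.
have tauo : L +oo%E tau by apply: LooB => //; exact: LooM.
have step x : Kperp theta x ->
    (adtt alpha beta psi (adtt theta alpha phi x) = adtt theta beta sigma x
       %[ae circle_measure R]) <->
    model beta (tau * x - psi * Pa alpha (phi * x)).
  by move=> Kx; rewrite aeqE; exact: adtt_product.
have tau0 : aeq tau 0 <-> (sigma = phi * psi %[ae circle_measure R]).
  rewrite aeqE; split; apply: filterS => t; rewrite /tau !fE.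
    by move=> /eqP; rewrite subr_eq0 => /eqP ->.
  by move=> ->; rewrite subrr.
have mb := inner_cmeas hbeta.
have al2 u : L 2%:E u -> cmeasurable (psi * Pa alpha u).
  by move=> u2; apply/L2_cmeas/L2M => //; exact: Pa_L2.
rewrite -tau0 -(cond_iff halpha hbeta htheta nalpha hphi hpsi); split.
  move=> H.
  have Hx x h g : L 2%:E x -> H2 h -> Hm g -> aeq x (theta * h + g) ->
      model beta (tau * x - psi * Pa alpha (phi * x)).
    move=> x2 Hh Hg e; have Kx := Kperp_intro htheta x2 Hh Hg e.
    by apply/(step x Kx); exact: H.
  have Hxm g : Hm g -> model beta (tau * g - psi * Pa alpha (phi * g)).
    move=> Hg; apply: (Hx g (cst 0) g (Hm_L2 Hg) (H2_cst 0) Hg).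
    by apply: aeW => t; rewrite !fE mulr0 add0r.
  have t0 : aeq tau 0.
    apply: (product_symbol halpha nalpha hphi hpsi tauo) => g Hg.
    by case: (Hxm g Hg).
  have drop x : L 2%:E x -> model beta (tau * x - psi * Pa alpha (phi * x)) ->
      model beta (psi * Pa alpha (phi * x)).
    move=> x2 /modelN; apply: model_aeq => //; last by apply: al2; exact: L2M.
    by apply: filterS t0 => t; rewrite !fE => ->; rewrite mul0r sub0r opprK.
  split; first exact: t0.
  split => [g Hg|h Hh]; apply: drop.
  - exact: Hm_L2.
  - exact: Hxm.
  - by apply: L2M; [exact: inner_Loo|exact: H2_L2].
  - apply: (Hx _ h (cst 0 * Jf 1) _ Hh).
    + by apply: L2M; [exact: inner_Loo|exact: H2_L2].
    + by apply/HmZ/Jf_H2; exact: (H2_cst 1).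
    + by apply: aeW => t; rewrite !fE mul0r addr0.
move=> [t0 [HA HB]] x Kx; apply/(step x Kx).
have [x2 _] := Kx; have [h [g [Hh Hg e]]] := Kperp_decomposition htheta Kx.
have px2 : L 2%:E (phi * x) by exact: L2M.
have ph2 : L 2%:E (phi * (theta * h)).
  by apply: L2M => //; apply: L2M; [exact: inner_Loo|exact: H2_L2].
have pg2 : L 2%:E (phi * g) by apply: L2M => //; exact: Hm_L2.
have pe : aeq (phi * x) (phi * (theta * h) + phi * g).
  by apply: filterS e => t; rewrite !fE => ->; rewrite mulrDr.
have PE := aeq_trans (Pa_aeq halpha px2 (L2D ph2 pg2) pe) (PaD halpha ph2 pg2).
apply: (model_aeq _ mb _ (modelN (modelD (HB _ Hh) (HA _ Hg)))).
  apply: filterS2 t0 PE => t; rewrite !fE => -> ->.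
  by move: (Pa _ _ t) (Pa _ (phi * g) t) => A B; ring.
by apply: cmeasD; [apply/L2_cmeas; exact: L2M|apply/cmeasN/al2].
Qed.
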